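(* Let $(n_j)_{j\in\mathbb{N}}$ be a sequence of natural numbers and let $\Phi=(\Phi_N)_{N\in\mathbb{N}}$ be a Følner sequence in $\mathbb{N}$. Assume that for all ergodic rotations $(Z,\mathcal{C},\nu,R_a)$ and all $f\in L^2(\nu)$, we have $$\lim_{N\to\infty}\mathbb{E}_{j\in\Phi_N}f(a^{n_j}x)=\int_Zf\,d\nu$$ in $L^2(\nu)$. Then for every ergodic invertible measure preserving system $(X,\mathcal{B},\mu,T)$ and all $f\in L^2(\mu)$, we have $$\lim_{N\to\infty}\mathbb{E}_{n\in\mathrm{IP}_{\Phi_N}((n_j)_{j\in\mathbb{N}})}T^nf=\int_Xf\,d\mu$$ in $L^2(\mu)$.
   Context: $\mathbb{N}=\{1,2,3,\dots\}$. An invertible measure preserving system $(X,\mathcal{B},\mu,T)$ consists of a probability space and an invertible measurable measure preserving $T:X\to X$; throughout, $X$ is a compact metric space, $\mathcal{B}$ its Borel $\sigma$-algebra and $\mu$ a regular measure. $T$ also denotes the operator $f\mapsto f\circ T$. An ergodic rotation $(Z,\mathcal{C},\nu,R_a)$ is a compact abelian group $Z$ (written multiplicatively here) with Borel $\sigma$-algebra, Haar probability measure $\nu$, and the transformation $R_a x=ax$ for a fixed $a\in Z$, which is ergodic. A Følner sequence in $\mathbb{N}$ is a sequence of finite sets $\Phi_N\subseteq\mathbb{N}$ with $\lim_{N\to\infty}|(a+\Phi_N)\Delta\Phi_N|/|\Phi_N|=0$ for all $a\in\mathbb{N}$. $\mathbb{E}_{j\in\Phi_N}b_j=\frac{1}{|\Phi_N|}\sum_{j\in\Phi_N}b_j$.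 For finite $F\subseteq\mathbb{N}$ put $n_F=\sum_{j\in F}n_j$ ($n_\emptyset=0$). $\mathrm{IP}_{\Phi_N}((n_j)_{j\in\mathbb{N}})$ is the multiset $\{n_F:F\subseteq\Phi_N\}$, and averages over it count multiplicity: $\mathbb{E}_{n\in\mathrm{IP}_{\Phi_N}((n_j)_{j\in\mathbb{N}})}a_n=2^{-|\Phi_N|}\sum_{F\subseteq\Phi_N}a_{n_F}$. *)

(* Defs.v *)
From HB Require Import structures.
From mathcomp Require Import all_boot all_order all_algebra finmap.
From mathcomp Require Import all_classical all_reals all_analysis.
From mathcomp Require Import complex.

Set Implicit Arguments.
Unset Strict Implicit.
Unset Printing Implicit Defensive.

Import Order.TTheory GRing.Theory Num.Theory.
Import numFieldNormedType.Exports.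

Local Open Scope classical_set_scope.
Local Open Scope ring_scope.

(* The library's measurable types are pointed; this loses no generality since
   a space carrying a probability measure is nonempty. *)
#[short(type="pointedMetricType")]
HB.structure Definition PointedMetric (R : numDomainType) :=
  {M of Pointed M & Metric R M}.

(* Topological groups are in the library's additive notation: the rotation by
   a is x |-> a + x, and the power a^n is a *+ n. *)
Definition zspace (Z : topologicalZmodType) : Type := Z.
HB.instance Definition _ (Z : topologicalZmodType) := Topological.on (zspace Z).
HB.instance Definition _ (Z : topologicalZmodType) :=
  isPointed.Build (zspace Z) (0 : Z).

Definition borel (X : ptopologicalType) := g_sigma_algebraType (@open X).
HB.instance Definition _ (X : ptopologicalType) := Measurable.on (borel X).

Notation zborel Z := (borel (zspace Z)).

Section systems.
Context {R : realType}.

Definition regular_measure (X : ptopologicalType)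
    (mu : probability (borel X) R) : Prop :=
  forall A : set (borel X), measurable A ->
    mu A = ereal_inf [set mu U | U in [set U : set X | open U /\ A `<=` U]] /\
    mu A = ereal_sup [set mu K | K in [set K : set X | compact K /\ K `<=` A]].

Record invertible_mps (X : ptopologicalType)
    (mu : probability (borel X) R) (T : borel X -> borel X) : Prop := {
  mps_compact : compact [set: X] ;
  mps_regular : regular_measure mu ;
  mps_measurable : measurable_fun setT T ;
  mps_invertible : exists S : borel X -> borel X,
    [/\ cancel T S, cancel S T & measurable_fun setT S] ;
  mps_preserving : forall A : set (borel X),
    measurable A -> mu (T @^-1` A) = mu A }.

Definition ergodic (X : ptopologicalType)
    (mu : probability (borel X) R) (T : borel X -> borel X) : Prop :=
  forall A : set (borel X), measurable A -> T @^-1` A = A ->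
    mu A = 0%E \/ mu A = 1%E.

Definition metrizable (Z : topologicalType) : Prop :=
  exists (M : metricType R) (f : Z -> M) (g : M -> Z),
    [/\ cancel f g, cancel g f, continuous f & continuous g].

Definition haar (Z : topologicalZmodType) (nu : probability (zborel Z) R) : Prop :=
  regular_measure nu /\
  forall (b : Z) (A : set (zborel Z)), measurable A ->
    nu [set b + z | z in (A : set Z)] = nu A.

Definition rotation (Z : topologicalZmodType) (a : Z) : zborel Z -> zborel Z :=
  fun x => a + (x : Z).

(* Rotations are measure preserving systems, hence live on compact metric
   spaces; the metric plays no role beyond the topology it induces. *)
Definition ergodic_rotation (Z : topologicalZmodType)
    (nu : probability (zborel Z) R) (a : Z) : Prop :=
  [/\ compact [set: Z], metrizable Z, haar nu & ergodic nu (rotation a)].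

End systems.

Section complex_L2.
Context {d : measure_display} {X : measurableType d} {R : realType}.
Variable mu : {measure set X -> \bar R}.

Definition L2norm (f : X -> R[i]) : \bar R :=
  Lnorm mu 2%:E (fun x => (complex.Re `|f x|)%:E).

Definition L2 (f : X -> R[i]) : Prop :=
  [/\ measurable_fun setT (fun x => complex.Re (f x)),
      measurable_fun setT (fun x => complex.Im (f x))
    & (L2norm f < +oo)%E].

Definition cintegral (f : X -> R[i]) : R[i] :=
  Complex (\int[mu]_x complex.Re (f x)) (\int[mu]_x complex.Im (f x)).

Definition cvgL2 (g : nat -> X -> R[i]) (h : X -> R[i]) : Prop :=
  L2norm (fun x => g N x - h x) @[N --> \oo] --> 0%E.

End complex_L2.

(* Sequences indexed by {1, 2, 3, ...} are functions on nat whose value at 0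
   is left unconstrained; subsets of {1, 2, 3, ...} are sets avoiding 0. *)
Section averages.

Definition symdiff (A B : {fset nat}) : {fset nat} :=
  ((A `\` B) `|` (B `\` A))%fset.

Definition Folner (R : realType) (Phi : nat -> {fset nat}) : Prop :=
  (forall N, (0 < N)%N -> Phi N != fset0 /\ 0%N \notin Phi N) /\
  (forall a, (0 < a)%N ->
     #|` symdiff [fset (a + j)%N | j in Phi N]%fset (Phi N)|%:R / #|` Phi N|%:R
       @[N --> \oo] --> (0 : R)).

Definition avg (K : fieldType) (A : {fset nat}) (b : nat -> K) : K :=
  #|` A|%:R^-1 * \sum_(j <- A) b j.

Definition IPavg (K : fieldType) (A : {fset nat}) (n : nat -> nat)
    (a : nat -> K) : K :=
  (2 ^+ #|` A|)^-1 * \sum_(F <- fpowerset A) a (\sum_(j <- F) n j)%N.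

End averages.

(* Main.v *)
From HB Require Import structures.
Require Import Defs.
From mathcomp Require Import all_boot all_order all_algebra finmap.
From mathcomp Require Import all_classical all_reals all_analysis.
From mathcomp Require Import measurable_realfun complex ring lra zify.

(* The average over IP_F((n_j)) of T^n is Q_F(T) with
     Q_F(z) = prod_(j in F) (1 + z^(n_j)) / 2,
   and for z = e^(it),
     |Q_F(z)|^2 = prod_(j in F) (1 + cos (n_j t)) / 2
               <= exp (- (1/2) sum_(j in F) (1 - cos (n_j t))).
   Applying the hypothesis to characters of finite cyclic groups and of the
   circle, the average of cos (n_j t) over Phi_N tends to 0 unless z = 1; since
   |Phi_N| tends to infinity, Q_(Phi_N) - A_N tends to 0 at every point of the
   unit circle, where A_N(z) = (1 + z + ... + z^(N-1)) / N.  Bounded convergence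
   for the spectral measure of f gives ||Q_(Phi_N)(T) f - A_N(T) f|| -> 0, so the
   statement follows from the mean ergodic theorem.  The spectral measure is
   replaced by a positive functional on continuous functions (an ultralimit of
   Fejer sums), for which bounded convergence has an elementary proof. *)

Set Implicit Arguments.
Unset Strict Implicit.
Unset Printing Implicit Defensive.

Import Order.TTheory GRing.Theory Num.Theory.
Import numFieldNormedType.Exports.

Local Open Scope classical_set_scope.
Local Open Scope ring_scope.

(** * The norm of L2 and means of bounded functions *)

(** At z = 1 the polynomial Q_(Phi_N) does not decay: that point carries the invariant functions.
    A_N equals 1 there too, so the difference tends to 0 at every point and the point 1 never has to
    be isolated, which a functional on continuous functions could not do. The exponential bound is 1
    + x <= e^x at x = -(1 - cos (n_j t)) / 2.

    The hypothesis speaks of one z at a time, with no uniformity in z, so only a bounded convergence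
    theorem can exploit it. The same theorem gives the mean ergodic theorem: A_N - A_M tends to 0 at
    every point as N and M grow, so the Cesaro means are Cauchy in L2. Their limit is then
    identified through strictly invariant sets, the only ones that ergodicity speaks of.

    All of this is done for bounded real f: products stay integrable, and the correlations of f are
    even, so cosines suffice. Jensen's inequality makes IP averages contractions, which lets
    truncation reach square integrable functions; complex f splits into real and imaginary parts. *)

Section L2norm_integral.
Context {d : measure_display} {X : measurableType d} {R : realType}.
Variable mu : {measure set X -> \bar R}.

Definition sqnorm (z : R[i]) : R := complex.Re z ^+ 2 + complex.Im z ^+ 2.

Lemma sqnorm_ge0 z : 0 <= sqnorm z.
Proof. by rewrite addr_ge0 ?sqr_ge0. Qed.

Lemma L2normE (f : X -> R[i]) :
  L2norm mu f = sqrte (\int[mu]_x (sqnorm (f x))%:E)%E.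
Proof.
rewrite /L2norm unlock -poweR12_sqrt; last first.
  by apply: integral_ge0 => x _; rewrite lee_fin sqnorm_ge0.
congr (_ `^ _)%E; apply: eq_integral => x _.
rewrite normc_def /= ger0_norm ?sqrtr_ge0// powR_mulrn ?sqrtr_ge0//.
by rewrite sqr_sqrtr ?sqnorm_ge0.
Qed.

Lemma cvg_sqrte0 (u : nat -> \bar R) : (forall N, 0 <= u N)%E ->
  sqrte (u N) @[N --> \oo] --> 0%E <-> u N @[N --> \oo] --> 0%E.
Proof.
move=> u0; split => [su|uu].
  have -> : u = (fun N => sqrte (u N) * sqrte (u N))%E.
    by apply/funext => N; rewrite -expe2 sqr_sqrte.
  by rewrite -[X in _ --> X](mule0 0%E); apply: cvgeM.
move/fine_cvgP : uu => [fu uu].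
apply/fine_cvgP; split; first by near=> N; rewrite sqrte_fin_num//; near: N.
have: Num.sqrt (fine (u N)) @[N --> \oo] --> Num.sqrt (0 : R).
  by apply: continuous_cvg => //; exact: sqrt_continuous.
rewrite sqrtr0; apply: cvg_trans; apply: near_eq_cvg.
near=> N => /=; have : u N \is a fin_num by near: N.
by case: (u N).
Unshelve. all: by end_near. Qed.

Lemma cvgL2P (g : nat -> X -> R[i]) h : cvgL2 mu g h <->
  (\int[mu]_x (sqnorm (g N x - h x))%:E)%E @[N --> \oo] --> 0%E.
Proof.
rewrite /cvgL2; under eq_cvg do rewrite L2normE.
by apply: cvg_sqrte0 => N; apply: integral_ge0 => x _; rewrite lee_fin sqnorm_ge0.
Qed.

End L2norm_integral.

Section bounded_measurable.
Context {d : measure_display} {X : measurableType d} {R : realType}.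
Variable mu : probability X R.
Implicit Types f g : X -> R.

(** Bounded functions form an algebra of integrable functions, so means are real numbers and the
    side conditions of linearity become closure rules. Unbounded functions return only with the
    truncation argument. *)
Definition bmeas f := measurable_fun setT f /\ exists C, forall x, `|f x| <= C.

Lemma bmeas_cst c : bmeas (fun=> c).
Proof. by split; [exact: measurable_cst|exists `|c|]. Qed.

Lemma bmeasD f g : bmeas f -> bmeas g -> bmeas (fun x => f x + g x).
Proof.
move=> [mf [C Cf]] [mg [D Dg]]; split; first exact: measurable_funD.
by exists (C + D) => x; rewrite (le_trans (ler_normD _ _))// lerD.
Qed.

Lemma bmeasM f g : bmeas f -> bmeas g -> bmeas (fun x => f x * g x).
Proof.
move=> [mf [C Cf]] [mg [D Dg]]; split; first exact: measurable_funM.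
by exists (C * D) => x; rewrite normrM ler_pM.
Qed.

Lemma bmeasZ c f : bmeas f -> bmeas (fun x => c * f x).
Proof. by apply: bmeasM; exact: bmeas_cst. Qed.

Lemma bmeasB f g : bmeas f -> bmeas g -> bmeas (fun x => f x - g x).
Proof.
move=> bf bg; under eq_fun do rewrite -mulN1r.
by apply: bmeasD => //; exact: bmeasZ.
Qed.

Lemma bmeasX2 f : bmeas f -> bmeas (fun x => f x ^+ 2).
Proof. by move=> bf; under eq_fun do rewrite expr2; exact: bmeasM. Qed.

Lemma bmeas_sum (I : Type) (s : seq I) (F : I -> X -> R) :
  (forall i, bmeas (F i)) -> bmeas (fun x => \sum_(i <- s) F i x).
Proof.
move=> bF; elim: s => [|i s IH].
  by under eq_fun do rewrite big_nil; exact: bmeas_cst.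
by under eq_fun do rewrite big_cons; exact: bmeasD.
Qed.

Lemma bmeas_comp (T : X -> X) f :
  measurable_fun setT T -> bmeas f -> bmeas (f \o T).
Proof.
move=> mT [mf [C Cf]]; split; first exact: measurableT_comp.
by exists C => x; exact: Cf.
Qed.

Lemma bmeas_integrable f : bmeas f -> mu.-integrable setT (EFin \o f).
Proof.
move=> [mf [C Cf]]; apply: measurable_bounded_integrable => //.
  by rewrite (le_lt_trans (probability_le1 _ _))// ltry.
exists C; split; first by rewrite num_real.
by move=> D CD x _; exact: le_trans (Cf x) (ltW CD).
Qed.

Definition mean f := (\int[mu]_x f x)%R.

Lemma eq_mean f g : f =1 g -> mean f = mean g.
Proof. by move=> fg; apply: eq_Rintegral => x _; exact: fg. Qed.

Lemma mean_cst c : mean (fun=> c) = c.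
Proof. by rewrite /mean Rintegral_cst// [X in fine X]probability_setT mulr1. Qed.

Lemma meanD f g : bmeas f -> bmeas g ->
  mean (fun x => f x + g x) = mean f + mean g.
Proof. by move=> bf bg; apply: RintegralD => //; exact: bmeas_integrable. Qed.

Lemma meanB f g : bmeas f -> bmeas g ->
  mean (fun x => f x - g x) = mean f - mean g.
Proof. by move=> bf bg; apply: RintegralB => //; exact: bmeas_integrable. Qed.

Lemma meanZ c f : bmeas f -> mean (fun x => c * f x) = c * mean f.
Proof. by move=> bf; apply: RintegralZl => //; exact: bmeas_integrable. Qed.

Lemma mean_sum (I : Type) (s : seq I) (F : I -> X -> R) :
  (forall i, bmeas (F i)) ->
  mean (fun x => \sum_(i <- s) F i x) = \sum_(i <- s) mean (F i).
Proof.
move=> bF; elim: s => [|i s IH].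
  by rewrite big_nil -[RHS](mean_cst 0); apply: eq_mean => x; rewrite big_nil.
rewrite big_cons -IH -meanD//; last exact: bmeas_sum.
by apply: eq_mean => x; rewrite big_cons.
Qed.

Lemma mean_ge0 f : (forall x, 0 <= f x) -> 0 <= mean f.
Proof. by move=> f0; apply: Rintegral_ge0. Qed.

Lemma le_mean f g : bmeas f -> bmeas g -> (forall x, f x <= g x) ->
  mean f <= mean g.
Proof.
by move=> bf bg fg; apply: le_Rintegral => //; exact: bmeas_integrable.
Qed.

Lemma EFin_mean f : bmeas f -> (mean f)%:E = (\int[mu]_x (f x)%:E)%E.
Proof.
move=> bf; rewrite /mean /Rintegral fineK//.
by apply: integrable_fin_num => //; exact: bmeas_integrable.
Qed.

Lemma mean_comp (T : X -> X) f : measurable_fun setT T ->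
  (forall A, measurable A -> mu (T @^-1` A) = mu A) -> bmeas f ->
  mean (f \o T) = mean f.
Proof.
move=> mT muT bf; have bfT := bmeas_comp mT bf.
rewrite /mean /Rintegral; congr fine.
have := @integral_pushforward _ _ _ _ R T mT mu setT (EFin \o f).
rewrite preimage_setT => <-//; last 2 first.
- by apply/measurable_EFinP; case: bf.
- exact: (bmeas_integrable bfT).
by apply: eq_measure_integral => A mA _; rewrite /pushforward; exact: muT.
Qed.

End bounded_measurable.

(** * Metric groups and characters *)

Section metric_group.
Variables (R : realType) (G : zmodType).

(** Translation invariance alone makes addition and negation continuous, so the cyclic groups and
    the circle become topological groups by one construction. *)
Record invariant_distance := InvariantDistance {
  idist :> G -> G -> R ;
  idistxx : forall x, idist x x = 0 ;
  idist_eq0 : forall x y, idist x y = 0 -> x = y ;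
  idist_sym : forall x y, idist x y = idist y x ;
  idist_triangle : forall y x z, idist x z <= idist x y + idist y z ;
  idistDl : forall z x y, idist (z + x) (z + y) = idist x y }.

Definition metric_group (d : invariant_distance) : Type := G.

Variable d : invariant_distance.

HB.instance Definition _ := GRing.Zmodule.on (metric_group d).
HB.instance Definition _ := isMetric.Build R (metric_group d)
  (idistxx d) (@idist_eq0 d) (idist_sym d) (@idist_triangle d).

Lemma ball_metric_group (x y : metric_group d) e : ball x e y = (d x y < e).
Proof. by []. Qed.

(** Translation by x + y sends - x to y and - y to x. *)
Lemma idistN (x y : G) : d (- x) (- y) = d x y.
Proof.
by rewrite -(idistDl d (x + y)) addrK addrAC subrr add0r idist_sym.
Qed.

Lemma metric_groupD_continuous :
  continuous (fun x : metric_group d * metric_group d => x.1 + x.2).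
Proof.
move=> [x y]; apply/cvg_ballP => e e0; exists (ball x (e / 2), ball y (e / 2)).
  by split; apply: nbhsx_ballx; rewrite divr_gt0.
move=> [x' y'] [] /=; rewrite !ball_metric_group => xx' yy'.
rewrite (splitr e) (le_lt_trans (idist_triangle d (x' + y) _ _))//.
by rewrite ltrD// ?idistDl// ![_ + y]addrC idistDl.
Qed.

Lemma metric_groupN_continuous :
  continuous (-%R : metric_group d -> metric_group d).
Proof.
move=> x; apply/(@cvg_ballP _ _ _ _ (nbhs_filter x)) => e e0.
apply/nbhs_ballP; exists e => // y.
by rewrite /= !ball_metric_group idistN.
Qed.

HB.instance Definition _ :=
  PreTopologicalNmodule_isTopologicalNmodule.Build (metric_group d)
    metric_groupD_continuous.
HB.instance Definition _ :=
  TopologicalNmodule_isTopologicalZmodule.Build (metric_group d)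
    metric_groupN_continuous.

Lemma metrizable_metric_group : @metrizable R (metric_group d).
Proof.
exists (metric_group d), id, id.
by split => [x|x|x A ?|x A ?]; [exact: erefl|exact: erefl|assumption|assumption].
Qed.

End metric_group.

(** * Borel measurability and regularity of measures *)

Section borel_measurable.
Variable R : realType.

Lemma borel_measurable_fun d (Y : measurableType d) (X : ptopologicalType)
    (f : Y -> borel X) :
  (forall U : set X, open U -> measurable (f @^-1` U)) -> measurable_fun setT f.
Proof.
move=> fU; apply: (@measurability _ _ Y (borel X) setT f open) => // _ [U oU <-].
by rewrite setTI; exact: fU.
Qed.

Lemma continuous_borel_measurable (X Y : ptopologicalType) (f : X -> Y) :
  continuous f -> measurable_fun setT (f : borel X -> borel Y).
Proof.
move=> /continuousP cf; apply: borel_measurable_fun => U oU.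
by apply: sub_sigma_algebra; exact: cf.
Qed.

Lemma continuous_borel_real (X : ptopologicalType) (f : X -> R) :
  continuous f -> measurable_fun setT (f : borel X -> R).
Proof.
move=> /continuousP cf; apply: (measurability _ (RGenOpens.measurableE R)).
move=> _ [_ [a [b ->] <-]]; rewrite setTI; apply: sub_sigma_algebra.
exact/cf/interval_open.
Qed.

(** Outer approximation of A comes from inner approximation of its complement: if K is compact
    inside [~] A, then [~] K is open, contains A and exceeds it in measure by at most e. *)
Lemma inner_regular (X : ptopologicalType) (mu : probability (borel X) R) :
  (forall K : set X, compact K -> closed K) ->
  (forall A : set (borel X), measurable A -> forall e : R, 0 < e ->
     exists2 K : set X, compact K /\ K `<=` A & (mu A <= mu K + e%:E)%E) ->
  regular_measure mu.
Proof.
move=> cK inn A mA.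
have mO (U : set X) : open U -> measurable (U : set (borel X)).
  by move=> oU; exact: sub_sigma_algebra.
have mK (K : set X) : compact K -> measurable (K : set (borel X)).
  move=> /cK cl; rewrite -[K]setCK.
  apply: (@measurableC _ (borel X)); apply: mO; exact: closed_openC.
split; apply/eqP; rewrite eq_le; apply/andP; split.
- apply: le_ereal_inf_tmp => _ [U [oU AU] <-].
  by apply: le_measure => //; rewrite inE//; exact: mO.
- apply/lee_addgt0Pr => e e0.
  have [K [Kc KA] muK] := inn (~` A) (measurableC mA) e e0.
  apply: ge_ereal_inf; exists (mu (~` K)).
    exists (~` K) => //; split; first by apply: closed_openC; exact: cK.
    by move=> x Ax Kx; exact: KA Kx Ax.
  move: muK; rewrite !probability_setC//; last exact: mK.
  have /fineK <- : mu A \is a fin_num by exact: fin_num_measure.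
  have /fineK <- : mu K \is a fin_num by apply: fin_num_measure; exact: mK.
  by rewrite -!EFinB -!EFinD !lee_fin; lra.
- apply/lee_addgt0Pr => e e0; have [K [Kc KA] muK] := inn A mA e e0.
  by rewrite (le_trans muK)// leeD2r//; apply: ereal_sup_ubound; exists K.
- apply: ge_ereal_sup => _ [K [Kc KA] <-].
  by apply: le_measure => //; rewrite inE//; exact: mK.
Qed.

End borel_measurable.

(** * Averages of an eigenfunction of modulus 1 along a rotation *)

Section character.
Variable R : realType.

Definition cis (t : R) : R[i] := Complex (cos t) (sin t).

Lemma cis0 : cis 0 = 1.
Proof. by rewrite /cis cos0 sin0. Qed.

Lemma cisD s t : cis (s + t) = cis s * cis t.
Proof. by apply/eqP; rewrite eq_complex /= cosD sinD eqxx/= addrC. Qed.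

Lemma sqnormM (z w : R[i]) : sqnorm (z * w) = sqnorm z * sqnorm w.
Proof. by case: z w => [a b] [c e]; rewrite /sqnorm /=; ring. Qed.

Lemma Re_sum (I : Type) (s : seq I) (F : I -> R[i]) :
  complex.Re (\sum_(i <- s) F i) = \sum_(i <- s) complex.Re (F i).
Proof. exact: (raddf_sum (@complex.Re R : Rcomplex R -> R)). Qed.

Lemma Im_sum (I : Type) (s : seq I) (F : I -> R[i]) :
  complex.Im (\sum_(i <- s) F i) = \sum_(i <- s) complex.Im (F i).
Proof. exact: (raddf_sum (@complex.Im R : Rcomplex R -> R)). Qed.

Variables (Z : topologicalZmodType) (nu : probability (zborel Z) R) (a : Z).
Variables (chi : zborel Z -> R[i]) (t : R).
Hypotheses (nuH : haar nu) (mRe : measurable_fun setT (fun x => complex.Re (chi x)))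
  (mIm : measurable_fun setT (fun x => complex.Im (chi x)))
  (chi1 : forall x, sqnorm (chi x) = 1)
  (chiD : forall x, chi (rotation a x) = cis t * chi x) (t1 : cos t != 1).

Lemma rotation_measurable : measurable_fun setT (rotation a : zborel Z -> zborel Z).
Proof.
apply: (@continuous_borel_measurable (zspace Z) (zspace Z)).
move=> x; apply: (@continuous_comp Z (Z * Z)%type Z (fun y => (a, y))
  (fun p => p.1 + p.2)).
  by apply: cvg_pair => //=; exact: cvg_cst.
exact: add_continuous.
Qed.

Lemma rotation_preserving (A : set (zborel Z)) : measurable A ->
  nu (rotation a @^-1` A) = nu A.
Proof.
move=> mA; rewrite -[RHS](nuH.2 (- a) A mA); congr (nu _).
apply/seteqP; split => [x /= Ax|_ [x Ax <-]].
  by exists (rotation a x) => //; rewrite /rotation addKr.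
by rewrite /= /rotation addNKr.
Qed.

(** Invariance of nu gives I = cis t * I for the integral I, and cis t differs from 1. *)
Lemma character_mean0 : cintegral nu chi = 0.
Proof.
have bRe : bmeas (fun x => complex.Re (chi x)).
  split=> //; exists 1 => x /=; rewrite -(@ler_pXn2r _ 2)// ?nnegrE//.
  by rewrite expr1n real_normK ?num_real// -(chi1 x) lerDl sqr_ge0.
have bIm : bmeas (fun x => complex.Im (chi x)).
  split=> //; exists 1 => x /=; rewrite -(@ler_pXn2r _ 2)// ?nnegrE//.
  by rewrite expr1n real_normK ?num_real// -(chi1 x) lerDr sqr_ge0.
set c := mean nu (fun x => complex.Re (chi x)); set s := mean nu (fun x => complex.Im (chi x)).
have mp := rotation_preserving.
have cE : c = cos t * c - sin t * s.
  rewrite -{1}[c](mean_comp rotation_measurable mp bRe).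
  rewrite -!meanZ// -meanB; [|exact: bmeasZ|exact: bmeasZ].
  by apply: eq_mean => x /=; rewrite chiD; case: (chi x).
have sE : s = cos t * s + sin t * c.
  rewrite -{1}[s](mean_comp rotation_measurable mp bIm).
  rewrite -!meanZ// -meanD; [|exact: bmeasZ|exact: bmeasZ].
  by apply: eq_mean => x /=; rewrite chiD; case: (chi x).
(* With I = c + i s, this is the real part of conj(I) * (I - cis t * I). *)
have : (1 - cos t) * (c ^+ 2 + s ^+ 2) = 0.
  have -> : (1 - cos t) * (c ^+ 2 + s ^+ 2) =
      c * (c - (cos t * c - sin t * s)) + s * (s - (cos t * s + sin t * c)).
    by ring.
  by rewrite -cE -sE !subrr !mulr0 addr0.
move/eqP; rewrite mulf_eq0 subr_eq0 eq_sym (negbTE t1)/=.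
rewrite paddr_eq0 ?sqr_ge0// !sqrf_eq0 => /andP[/eqP c0 /eqP s0].
by apply/eqP; rewrite eq_complex /= -/(mean nu _) -/(mean nu _) -/c -/s c0 s0 eqxx.
Qed.

Lemma character_power k x : chi (rotation (a *+ k) x) = cis (k%:R * t) * chi x.
Proof.
elim: k => [|k IH]; first by rewrite mul0r cis0 mul1r /rotation mulr0n add0r.
have -> : rotation (a *+ k.+1) x = rotation a (rotation (a *+ k) x).
  by rewrite /rotation addrA -mulrS.
by rewrite chiD IH mulrA -cisD -[k.+1]add1n natrD mulrDl mul1r.
Qed.

(** The averaged function is the constant [z N] times chi. As chi has modulus 1, the L2 norm in the
    hypothesis is the modulus of [z N], which dominates its real part, the average of cosines. *)
Lemma character_average (n : nat -> nat) (Phi : nat -> {fset nat}) :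
  cvgL2 nu (fun N x => avg (Phi N) (fun j => chi (rotation (a *+ n j) x)))
    (fun=> cintegral nu chi) ->
  avg (Phi N) (fun j => cos ((n j)%:R * t)) @[N --> \oo] --> 0.
Proof.
rewrite character_mean0 => /cvgL2P.
pose z N := avg (Phi N) (fun j => cis ((n j)%:R * t)).
have zE N x : avg (Phi N) (fun j => chi (rotation (a *+ n j) x)) = z N * chi x.
  by rewrite /z /avg -mulrA mulr_suml; under eq_bigr do rewrite character_power.
have iE N : (\int[nu]_x (sqnorm (avg (Phi N)
    (fun j => chi (rotation (a *+ n j) x)) - 0))%:E)%E = (sqnorm (z N))%:E.
  under eq_integral do rewrite zE subr0 sqnormM chi1 mulr1.
  by rewrite integral_cst// [X in (_ * X)%E]probability_setT mule1.
under eq_cvg do rewrite iE.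
move=> /fine_cvgP[_ sz].
have Rez N : complex.Re (z N) = avg (Phi N) (fun j => cos ((n j)%:R * t)).
  rewrite /z /avg -(rmorph_nat (real_complex R)) -fmorphV /=.
  have <- : complex.Re (\sum_(j <- Phi N) cis ((n j)%:R * t)) =
    \sum_(j <- Phi N) cos ((n j)%:R * t) by rewrite Re_sum.
  case: (\sum_(_ <- _) _) => u v /=.
  by rewrite mul0r subr0.
apply/norm_cvg0P.
have: Num.sqrt (sqnorm (z N)) @[N --> \oo] --> Num.sqrt (0 : R).
  by apply: continuous_cvg => //; exact: sqrt_continuous.
rewrite sqrtr0; apply: squeeze_cvgr (cvg_cst 0).
apply: nearW => N /=; rewrite normr_ge0 -Rez -sqrtr_sqr ler_sqrt ?sqnorm_ge0//.
by rewrite lerDl sqr_ge0.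
Qed.

Lemma character_L2 : L2 nu chi.
Proof.
split=> //; rewrite L2normE; under eq_integral do rewrite chi1.
by rewrite integral_cst// [X in (_ * X)%E]probability_setT mul1e /= ltry.
Qed.

End character.

Definition equidistributed (R : realType) (n : nat -> nat)
    (Phi : nat -> {fset nat}) : Prop :=
  forall (Z : topologicalZmodType) (nu : probability (zborel Z) R) (a : Z),
    ergodic_rotation nu a -> forall f : zborel Z -> R[i], L2 nu f ->
    cvgL2 nu (fun N x => avg (Phi N) (fun j => f (rotation (a *+ n j) x)))
      (fun=> cintegral nu f).

(** * Finite cyclic rotations *)

Section cyclic_group.
Variables (R : realType) (q : nat).

(** The 0-1 metric is translation invariant and makes every subset open, hence Borel. *)
Definition discrete_dist (x y : 'I_q.+1) : R := (x != y)%:R.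

Lemma discrete_distxx x : discrete_dist x x = 0.
Proof. by rewrite /discrete_dist eqxx. Qed.

Lemma discrete_dist_eq0 x y : discrete_dist x y = 0 -> x = y.
Proof.
by move/eqP; rewrite /discrete_dist pnatr_eq0 eqb0 negbK => /eqP.
Qed.

Lemma discrete_dist_sym x y : discrete_dist x y = discrete_dist y x.
Proof. by rewrite /discrete_dist eq_sym. Qed.

Lemma discrete_dist_triangle y x z :
  discrete_dist x z <= discrete_dist x y + discrete_dist y z.
Proof.
rewrite /discrete_dist -natrD ler_nat.
by case: (eqVneq x y) => [->|]//=; case: (x != z).
Qed.

Lemma discrete_distDl z x y : discrete_dist (z + x) (z + y) = discrete_dist x y.
Proof. by rewrite /discrete_dist (inj_eq (addrI z)). Qed.

Definition cyclic_group := metric_group (InvariantDistance discrete_distxx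
  discrete_dist_eq0 discrete_dist_sym discrete_dist_triangle discrete_distDl).

HB.instance Definition _ := TopologicalZmodule.on cyclic_group.

Lemma cyclic_open (A : set cyclic_group) : open A.
Proof.
rewrite openE => x Ax; apply/nbhs_ballP; exists 1 => //= y.
rewrite ball_metric_group /= /discrete_dist; case: eqVneq => [<-//|_ /=].
by rewrite ltxx.
Qed.

Lemma cyclic_compact (A : set cyclic_group) : compact A.
Proof. apply: finite_compact; exact: (@finite_finset 'I_q.+1). Qed.

Lemma cyclic_measurable (A : set (zborel cyclic_group)) : measurable A.
Proof. by apply: sub_sigma_algebra; exact: cyclic_open. Qed.

(** Normalised counting measure, assembled from Dirac masses so that the measure structure is
    inherited. *)
Definition cyclic_uniform : set (zborel cyclic_group) -> \bar R :=
  mscale (q.+1%:R^-1)%:nng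
    (msum (fun k => \d_(inord k : zborel cyclic_group)) q.+1).

HB.instance Definition _ := Measure.on cyclic_uniform.

Lemma cyclic_uniformE A : cyclic_uniform A =
  (q.+1%:R^-1 * \sum_(i < q.+1) ((i : zborel cyclic_group) \in A)%:R)%:E.
Proof.
rewrite /cyclic_uniform /mscale /= /msum EFinM -sumEFin; congr (_ * _)%E.
by apply: eq_bigr => i _; rewrite inord_val.
Qed.

Lemma cyclic_uniform_setT : cyclic_uniform setT = 1%E.
Proof.
rewrite cyclic_uniformE; under eq_bigr do rewrite in_setT.
by rewrite sumr_const card_ord mulVf// pnatr_eq0.
Qed.

HB.instance Definition _ :=
  Measure_isProbability.Build _ _ _ cyclic_uniform cyclic_uniform_setT.

Lemma cyclic_haar : haar (cyclic_uniform : probability _ R).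
Proof.
split=> [|b A mA].
  apply: inner_regular => [K _|A _ e e0].
    by rewrite -[K]setCK; exact/open_closedC/cyclic_open.
  by exists A; [split=> //; exact: cyclic_compact|rewrite leeDl// lee_fin ltW].
rewrite [LHS]cyclic_uniformE [RHS]cyclic_uniformE; congr (_ * _)%:E.
rewrite (reindex_inj (addrI (b : 'I_q.+1))) /=; apply: eq_bigr => i _.
congr (_ *+ nat_of_bool _); apply/idP/idP.
  by move/set_mem => [x Ax /addrI xi]; apply/mem_set; rewrite -xi.
by move/set_mem => Ai; apply/mem_set; exists i.
Qed.

Definition cyclic_gen : cyclic_group := inZp 1 : 'I_q.+1.

Lemma cyclic_gen_mulrn k : cyclic_gen *+ k = (inZp k : 'I_q.+1).
Proof.
transitivity ((inZp 1 : 'I_q.+1) *+ k); first by [].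
by rewrite Zp_mulrn; apply: val_inj; rewrite /= modnMml mul1n.
Qed.

(** An invariant set with one point contains the orbit of that point, and 1 generates the group. *)
Lemma cyclic_ergodic :
  ergodic (cyclic_uniform : probability _ R) (rotation cyclic_gen).
Proof.
move=> A mA TA; have [->|/set0P[x Ax]] := eqVneq A set0.
  by left; rewrite measure0.
suff -> : A = setT by right; exact: cyclic_uniform_setT.
have AT z : A z -> A (rotation cyclic_gen z) by move=> Az; rewrite -TA in Az.
have Ak k : A (rotation (cyclic_gen *+ k) x).
  elim: k => [|k IH]; first by rewrite mulr0n /rotation add0r.
  by move: (AT _ IH); rewrite /rotation addrA -mulrS.
apply/seteqP; split => // y _.
have -> : y = rotation (cyclic_gen *+ (@GRing.add 'I_q.+1 y (- x)%R : 'I_q.+1)) x; last exact: Ak.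
by rewrite /rotation cyclic_gen_mulrn valZpK; exact/esym/(@subrK 'I_q.+1).
Qed.

End cyclic_group.

(** Since q + 1 times t is a multiple of 2 pi, the function cis (x t) is well defined for residues x
    modulo q + 1; it is an eigenfunction of the rotation by 1, with eigenvalue cis t. *)
Lemma rational_average (R : realType) n Phi q (t : R) :
  equidistributed R n Phi -> cis (q.+1%:R * t) = 1 -> cos t != 1 ->
  avg (Phi N) (fun j => cos ((n j)%:R * t)) @[N --> \oo] --> 0.
Proof.
move=> equi tq t1.
pose chi (x : zborel (cyclic_group R q)) := cis ((x : 'I_q.+1)%:R * t).
have sq1 u : sqnorm (@cis R u) = 1 by rewrite /sqnorm /= cos2Dsin2.
have mchi g : measurable_fun setT (g : zborel (cyclic_group R q) -> R).
  by move=> _ B mB; exact: cyclic_measurable.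
have cis_mod k : cis ((k %% q.+1)%N%:R * t) = cis (k%:R * t).
  rewrite [in RHS](divn_eq k q.+1) natrD natrM mulrDl cisD -mulrA.
  suff -> : cis ((k %/ q.+1)%:R * (q.+1%:R * t)) = 1 by rewrite mul1r.
  elim: (k %/ q.+1)%N => [|m IH]; first by rewrite mul0r cis0.
  by rewrite -natr1 mulrDl mul1r cisD IH tq mul1r.
have chiD x : chi (rotation (cyclic_gen R q) x) = cis t * chi x.
  rewrite /chi /rotation /= cis_mod.
  by rewrite natrD mulrDl cisD cis_mod mul1r.
pose nu : probability (zborel (cyclic_group R q)) R := @cyclic_uniform R q.
have nuH : haar nu by exact: cyclic_haar.
have chi1 x : sqnorm (chi x) = 1 by exact: sq1.
apply: (character_average (nu := nu) (a := @cyclic_gen R q) (chi := chi)) => //.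
have L2chi : L2 nu chi by apply: character_L2.
have er : ergodic_rotation nu (@cyclic_gen R q).
  by split=> //; [exact: cyclic_compact|exact: metrizable_metric_group
    |exact: cyclic_ergodic].
exact: (equi (cyclic_group R q) nu _ er chi L2chi).
Qed.

(** * Irrational rotations of the circle *)

Section unit_circle.
Variable R : realType.

Lemma cis_sqnorm (t : R) : sqnorm (cis t) = 1.
Proof. by rewrite /sqnorm /= cos2Dsin2. Qed.

(** Complex multiplication becomes the addition of the group structure below, so [ucval] itself is
    the character used for irrational rotations. *)
Record unit_circle := UnitCircle { ucval :> R[i]; _ : sqnorm ucval == 1 }.

HB.instance Definition _ := [isSub for ucval].
HB.instance Definition _ := [Choice of unit_circle by <:].

Lemma uc_sqnorm (z : unit_circle) : sqnorm z = 1.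
Proof. by case: z => z /= /eqP. Qed.

Fact uc_mul_subproof (z w : unit_circle) : sqnorm (ucval z * ucval w) == 1.
Proof. by rewrite sqnormM !uc_sqnorm mulr1. Qed.

Fact uc_one_subproof : sqnorm (1 : R[i]) == 1.
Proof. by rewrite /sqnorm /= expr1n expr0n addr0. Qed.

Fact uc_conj_subproof (z : unit_circle) :
  sqnorm (Complex (complex.Re (ucval z)) (- complex.Im (ucval z))) == 1.
Proof. by rewrite /sqnorm /= sqrrN; case: z. Qed.

Definition uc_mul z w := UnitCircle (uc_mul_subproof z w).
Definition uc_one := UnitCircle uc_one_subproof.
Definition uc_conj z := UnitCircle (uc_conj_subproof z).

Lemma uc_mulA : associative uc_mul.
Proof. by move=> x y z; apply: val_inj; rewrite /= mulrA. Qed.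

Lemma uc_mulC : commutative uc_mul.
Proof. by move=> x y; apply: val_inj; rewrite /= mulrC. Qed.

Lemma uc_mul1 : left_id uc_one uc_mul.
Proof. by move=> x; apply: val_inj; rewrite /= mul1r. Qed.

Lemma uc_mulV : left_inverse uc_one uc_conj uc_mul.
Proof.
move=> x; apply: val_inj => /=; have := uc_sqnorm x; case: (ucval x) => a b /=.
rewrite /sqnorm /= => ab; apply/eqP; rewrite eq_complex /= -ab.
by apply/andP; split; apply/eqP; ring.
Qed.

HB.instance Definition _ :=
  GRing.isZmodule.Build unit_circle uc_mulA uc_mulC uc_mul1 uc_mulV.

Definition chord (z w : unit_circle) : R := Normc.normc (ucval z - ucval w).

Lemma chordxx z : chord z z = 0.
Proof. by rewrite /chord subrr Normc.normc0. Qed.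

Lemma chord_eq0 z w : chord z w = 0 -> z = w.
Proof.
by move=> /Normc.eq0_normc/eqP; rewrite subr_eq0 => /eqP zw; exact: val_inj.
Qed.

Lemma chord_sym z w : chord z w = chord w z.
Proof. by rewrite /chord -opprB normcN. Qed.

Lemma chord_triangle y x z : chord x z <= chord x y + chord y z.
Proof. by rewrite /chord -[_ - _](subrKA (ucval y)) le_normcD. Qed.

Lemma chordDl z x y : chord (z + x) (z + y) = chord x y.
Proof.
rewrite /chord /= -mulrBr Normc.normcM.
suff -> : Normc.normc (ucval z) = 1 by rewrite mul1r.
by have := uc_sqnorm z; case: (ucval z) => a b; rewrite /sqnorm /= => ->; rewrite sqrtr1.
Qed.

Definition circle := metric_group (InvariantDistance chordxx chord_eq0
  chord_sym chord_triangle chordDl).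

HB.instance Definition _ := TopologicalZmodule.on circle.
HB.instance Definition _ := Metric.on circle.

Fact ecirc_subproof (x : R) : sqnorm (cis (pi *+ 2 * x)) == 1.
Proof. by rewrite cis_sqnorm. Qed.

(** Angles are counted in turns: the integers are periods, and subsets of the circle are studied
    through their 1-periodic preimages in the line. *)
Definition ecirc (x : R) : circle := UnitCircle (ecirc_subproof x).

Lemma ecircD x y : ecirc (x + y) = ecirc x + ecirc y.
Proof. by apply: val_inj; rewrite /= mulrDr cisD. Qed.

Lemma ecirc1 : ecirc 1 = 0.
Proof. by apply: val_inj; rewrite /= mulr1 /cis cos2pi sin2pi. Qed.

(** [acos] reaches only the upper half circle; a point with negative imaginary part takes the
    opposite angle, hence an interval symmetric about 0. *)
Lemma ecirc_surj (z : circle) : exists2 x, x \in `[-1, 1] & ecirc x = z.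
Proof.
have := uc_sqnorm z; case E : (ucval z) => [a b]; rewrite /sqnorm /= => ab.
have a1 : -1 <= a <= 1.
  by rewrite -ler_norml -(@ler_pXn2r _ 2)// ?nnegrE// expr1n real_normK
    ?num_real// -ab lerDl sqr_ge0.
have pi0 : 0 < (pi : R) *+ 2 by rewrite pmulrn_lgt0// pi_gt0.
have [s [s1 ce se]] : exists s, [/\ `|s| <= pi, cos s = a & sin s = b].
  have sb : Num.sqrt (1 - a ^+ 2) = `|b| by rewrite -ab addrC addKr sqrtr_sqr.
  have [b0|b0] := leP 0 b.
    exists (acos a); split; last by rewrite sin_acos// sb ger0_norm.
      by rewrite ger0_norm ?acos_ge0 ?acos_lepi.
    by rewrite acosK// in_itv.
  exists (- acos a); split.
  - by rewrite normrN ger0_norm ?acos_ge0 ?acos_lepi.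
  - by rewrite cosN acosK// in_itv.
  - by rewrite sinN sin_acos// sb ltr0_norm// opprK.
exists (s / (pi *+ 2)).
  rewrite in_itv /= -ler_norml normrM normfV (gtr0_norm pi0).
  by rewrite ler_pdivrMr// mul1r (le_trans s1)// mulr2n lerDl pi_ge0.
by apply: val_inj; rewrite /= mulrC divfK ?gt_eqF// /cis ce se E.
Qed.

Lemma ecirc_continuous : continuous (ecirc : R -> circle).
Proof.
move=> x; apply/cvg_ballP => e e0.
have cc : cos (pi *+ 2 * y) @[y --> x] --> cos (pi *+ 2 * x).
  by apply: continuous_comp; [exact: mulrl_continuous|exact: continuous_cos].
have cs : sin (pi *+ 2 * y) @[y --> x] --> sin (pi *+ 2 * x).
  by apply: continuous_comp; [exact: mulrl_continuous|exact: continuous_sin].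
have e2 : 0 < e / 2 by rewrite divr_gt0.
near=> y; rewrite ball_metric_group /= /chord /=.
rewrite -[e]gtr0_norm// -sqrtr_sqr ltr_sqrt ?exprn_gt0//.
have : `|cos (pi *+ 2 * x) - cos (pi *+ 2 * y)| < e / 2.
  by near: y; move/cvgrPdist_lt : cc; apply.
have : `|sin (pi *+ 2 * x) - sin (pi *+ 2 * y)| < e / 2.
  by near: y; move/cvgrPdist_lt : cs; apply.
rewrite !ltr_norml => /andP[u1 u2] /andP[v1 v2]; nra.
Unshelve. all: by end_near. Qed.

Lemma circle_compact : compact [set: circle].
Proof.
have -> : [set: circle] = ecirc @` `[-1, 1].
  by apply/seteqP; split => // z _; have [x ? <-] := ecirc_surj z; exists x.
apply: continuous_compact; last exact: segment_compact.
exact/continuous_subspaceT/ecirc_continuous.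
Qed.

End unit_circle.

(** * Density of periodic subsets of the line *)

Section periodic_sets.
Variable R : realType.
Local Notation lam := (@lebesgue_measure R).

Lemma shift_measurable (t : R) : measurable_fun setT (fun x : R => x + t).
Proof. by apply: measurable_funD => //; exact: measurable_cst. Qed.

Lemma shift_preimage_oc (t a b : R) :
  (fun x : R => x + t) @^-1` `]a, b] = `]a - t, b - t]%classic.
Proof.
by apply/seteqP; split => x /=; rewrite !in_itv /= ltrBlDr lerBrDr.
Qed.

(** The push-forward of Lebesgue measure by the translation agrees with it on half-open intervals,
    which determine it. *)
Lemma lebesgue_shift (t : R) (A : set R) : measurable A ->
  lam ((fun x => x + t) @^-1` A) = lam A.
Proof.
have mf : measurable_fun setT ((fun x : R => x + t) : R -> measurableTypeR R).
  exact: shift_measurable.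
pose nu := measure_function_pushforward__canonical__measure_function_Measure lam mf.
move=> mA; rewrite [RHS](@lebesgue_measure_unique R nu _ A mA)// => _ [[a b] _ <-].
rewrite /nu /= /pushforward /= shift_preimage_oc !lebesgue_measure_itv /=.
rewrite !lte_fin ltrD2r; case: ifP => // _; rewrite -!EFinB; congr (_%:E).
by rewrite opprB addrA subrK.
Qed.

Definition period (P : set R) (s : R) := forall x, P (x + s) <-> P x.

Lemma periodD P s t : period P s -> period P t -> period P (s + t).
Proof. by move=> ps pt x; rewrite addrA; split=> [/pt/ps|/ps/pt]. Qed.

Lemma periodN P s : period P s -> period P (- s).
Proof. by move=> ps x; split=> [/ps|Px]; [rewrite subrK|apply/ps; rewrite subrK]. Qed.

Lemma period_muln P s k : period P s -> period P (k%:R * s).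
Proof.
move=> ps; elim: k => [|k IH]; first by move=> x; rewrite mul0r addr0.
by rewrite -natr1 mulrDl mul1r; exact: periodD.
Qed.

Variable P : set R.
Hypothesis mP : measurable P.

(** Half-open intervals make adjacent windows disjoint, so that they add up exactly. *)
Definition window (y z : R) : R := fine (lam (P `&` `]y, z])).

Lemma window_fin y z : lam (P `&` `]y, z]) \is a fin_num.
Proof.
rewrite ge0_fin_numE//; apply: (@le_lt_trans _ _ (lam `]y, z])).
  by apply: le_measure; rewrite ?inE//; exact: measurableI.
by rewrite lebesgue_measure_itv /=; case: ifP => _; rewrite -?EFinB ltry.
Qed.

Lemma windowE y z : lam (P `&` `]y, z]) = (window y z)%:E.
Proof. by rewrite fineK// window_fin. Qed.

Lemma window_ge0 y z : 0 <= window y z.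
Proof. by rewrite fine_ge0. Qed.

Lemma window_le y z : y <= z -> window y z <= z - y.
Proof.
move=> yz; rewrite -lee_fin -windowE; apply: (@le_trans _ _ (lam `]y, z])).
  by apply: le_measure; rewrite ?inE//; exact: measurableI.
rewrite lebesgue_measure_itv /= lte_fin.
by case: ifP => // _; rewrite lee_fin subr_ge0.
Qed.

Lemma windowD y z w : y <= z -> z <= w -> window y w = window y z + window z w.
Proof.
move=> yz zw; apply/EFin_inj; rewrite EFinD -!windowE -measureU.
- rewrite -setIUr; congr (lam (P `&` _)).
  rewrite (@itv_bndbnd_setU _ _ (BRight y) (BRight z) (BRight w))//.
- exact: measurableI.
- exact: measurableI.
- rewrite -subset0 => x [[_ +] [_]] /=; rewrite !in_itv /=.
  by move=> /andP[_ xz] /andP[zx _]; move: (lt_le_trans zx xz); rewrite ltxx.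
Qed.

Lemma window_shift s y z : period P s -> window (y + s) (z + s) = window y z.
Proof.
move=> ps; rewrite /window -[in LHS](@lebesgue_shift s); last exact: measurableI.
congr (fine (lam _)); rewrite preimage_setI shift_preimage_oc !addrK.
by congr (_ `&` _); apply/seteqP; split => x /ps.
Qed.

(** Sliding a window of length s by h <= s drops a piece of length h and gains its translate by s,
    of equal measure. Any displacement is k such slides of length (z - y) / k, for k large
    enough. *)
Lemma window_period s y z : 0 < s -> period P s ->
  window y (y + s) = window z (z + s).
Proof.
move=> s0 ps.
have step u h : 0 <= h <= s -> window (u + h) (u + h + s) = window u (u + s).
  move=> /andP[h0 hs].
  rewrite (@windowD (u + h) (u + s)) ?lerD2l//; last first.
    by rewrite addrAC lerDl.
  rewrite -(addrAC u s h) (addrAC u s h) window_shift//.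
  by rewrite [RHS](@windowD u (u + h)) ?lerDl ?lerD2l// [RHS]addrC.
have steps k u h : 0 <= h <= s ->
    window (u + k%:R * h) (u + k%:R * h + s) = window u (u + s).
  move=> hs; elim: k => [|k IH]; first by rewrite mul0r addr0.
  by rewrite -natr1 mulrDl mul1r addrA step.
wlog yz : y z / y <= z.
  by move=> W; have [/W//|/ltW/W] := leP y z.
pose k := (Num.truncn ((z - y) / s)).+1; pose h := (z - y) / k%:R.
have -> : z = y + k%:R * h by rewrite /h mulrC divfK ?pnatr_eq0// addrC subrK.
rewrite steps// /h divr_ge0 ?subr_ge0//= ler_pdivrMr ?ltr0n// mulrC.
by rewrite -ler_pdivrMr// ltW// truncnS_gt.
Qed.

Lemma window_muln s y k : 0 < s -> period P s ->
  window y (y + k%:R * s) = k%:R * window 0 s.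
Proof.
move=> s0 ps; elim: k => [|k IH].
  rewrite !mul0r addr0 /window set_itvoc0 setI0 measure0//.
rewrite -natr1 !mulrDl !mul1r addrA (@windowD y (y + k%:R * s)); last 2 first.
- by rewrite lerDl mulr_ge0// ltW.
- by rewrite lerDl ltW.
by rewrite IH (window_period (y + k%:R * s) 0 s0 ps) add0r.
Qed.

(** If k s <= x <= (k + 1) s, the window lies between k w and (k + 1) w, where w <= s is the measure
    of P in one period; the error is at most one w. *)
Lemma window_density s y x : 0 < s -> period P s -> 0 <= x ->
  `|window y (y + x) - x * (window 0 s / s)| <= s.
Proof.
move=> s0 ps x0; pose k := Num.truncn (x / s); pose w := window 0 s.
have w1 : w / s <= 1 by rewrite ler_pdivrMr// mul1r -[leRHS]subr0 window_le ?ltW.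
have w0 : 0 <= w / s by rewrite divr_ge0 ?window_ge0// ltW.
have kx : k%:R * s <= x by rewrite -ler_pdivlMr// Num.Theory.truncn_le divr_ge0// ltW.
have xk : x <= k.+1%:R * s by rewrite -ler_pdivrMr// ltW// truncnS_gt.
have lo : k%:R * w <= window y (y + x).
  rewrite -(window_muln y k s0 ps) (@windowD y (y + k%:R * s) (y + x)) ?lerD2l//.
    by rewrite lerDl window_ge0.
  by rewrite lerDl mulr_ge0// ltW.
have hi : window y (y + x) <= k.+1%:R * w.
  rewrite -(window_muln y k.+1 s0 ps) (@windowD y (y + x) (y + k.+1%:R * s)).
  - by rewrite lerDl window_ge0.
  - by rewrite lerDl.
  - by rewrite lerD2l.
have wE : w = w / s * s by rewrite divfK// gt_eqF.
rewrite wE -natr1 in hi; rewrite wE in lo; rewrite -natr1 in xk.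
rewrite -/w ler_norml.
set r := w / s in w0 w1 hi lo *; set K : R := k%:R in kx xk lo hi *.
have A : 0 <= r * (x - K * s) by rewrite mulr_ge0// subr_ge0.
have B : 0 <= r * ((K + 1) * s - x) by rewrite mulr_ge0// subr_ge0.
have C : 0 <= (1 - r) * s by rewrite mulr_ge0 ?subr_ge0 ?(ltW s0).
nra.
Qed.

(** For each period s, both sides are close to x times the density over one period: the left one up
    to s, the right one up to x s. The sum s (1 + x) explains the choice of s below e / (1 + x). *)
Lemma window_small_periods :
  (forall e, 0 < e -> exists2 s, 0 < s <= e & period P s) ->
  forall y x, 0 <= x -> window y (y + x) = x * window 0 1.
Proof.
move=> small y x x0; apply/eqP; rewrite -subr_eq0 -normr_le0.
apply/ler_addgt0Pl => e e0; rewrite addr0.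
have [s /andP[s0 se] ps] := small (e / (1 + x))
  (divr_gt0 e0 (ltr_wpDr x0 ltr01)).
have := window_density y s0 ps x0; have := window_density 0 s0 ps ler01.
rewrite add0r mul1r; set r := window 0 s / s => d1 dx.
rewrite ler_pdivlMr in se; last by rewrite ltr_wpDr.
apply: le_trans se; rewrite mulrDr mulr1.
rewrite -(subrK (x * r) (window y _)) -addrA (le_trans (ler_normD _ _))// lerD//.
rewrite -mulrBr normrM ger0_norm// mulrC ler_wpM2r// distrC//.
Qed.

End periodic_sets.

(** * Haar measure of the circle and ergodicity of irrational rotations *)

Section circle_measure.
Variable R : realType.
Local Notation lam := (@lebesgue_measure R).
Local Notation C := (circle R).

Lemma ecirc_measurable : measurable_fun setT (@ecirc R : R -> zborel C).
Proof.
apply: borel_measurable_fun => U oU; apply: open_measurable.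
by move/continuousP: (@ecirc_continuous R); exact.
Qed.

Lemma ecirc_preimage_measurable (A : set (zborel C)) : measurable A ->
  measurable (@ecirc R @^-1` A : set R).
Proof.
by move=> mA; rewrite -[X in measurable X]setTI; exact: ecirc_measurable.
Qed.

Definition circle_measure : {measure set (zborel C) -> \bar R} :=
  measure_function_pushforward__canonical__measure_function_Measure
    (mrestr lam (measurable_itv `]0 : R, 1])) ecirc_measurable.

Definition circle_prob : set (zborel C) -> \bar R := circle_measure.

HB.instance Definition _ := Measure.on circle_prob.

Lemma circle_probE (A : set (zborel C)) :
  circle_prob A = lam (@ecirc R @^-1` A `&` `]0, 1]).
Proof. by []. Qed.

Lemma circle_prob_setT : circle_prob setT = 1%E.
Proof.
rewrite circle_probE preimage_setT setTI lebesgue_measure_itv /= lte_fin ltr01.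
by rewrite oppr0 adde0.
Qed.

HB.instance Definition _ :=
  Measure_isProbability.Build _ _ _ circle_prob circle_prob_setT.

Lemma ecirc_preimage_period (A : set C) : period (@ecirc R @^-1` A) 1.
Proof. by move=> x; rewrite /= ecircD ecirc1 addr0. Qed.

Lemma circle_compact_closed (K : set C) : compact K -> closed K.
Proof. by apply: compact_closed; exact: metric_hausdorff. Qed.

(** Inner regularity is transported from the line: the image of a compact subset of the preimage is
    compact. For invariance, rotating A shifts its preimage, and a window of length 1 on a
    1-periodic set has the same measure wherever it stands. *)
Lemma circle_haar : haar (circle_prob : probability _ R).
Proof.
split=> [|b A mA].
  apply: inner_regular => [|A mA e e0]; first exact: circle_compact_closed.
  have mP := ecirc_preimage_measurable mA.
  have mPI : measurable (@ecirc R @^-1` A `&` `]0, 1]) by exact: measurableI.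
  have fP : (lam (@ecirc R @^-1` A `&` `]0%R, 1%R]) < +oo)%E.
    by rewrite -ge0_fin_numE// window_fin.
  have [K [cK KA lK]] := lebesgue_regularity_inner mPI fP e0.
  have ceK : compact (@ecirc R @` K).
    apply: continuous_compact => //.
    exact/continuous_subspaceT/ecirc_continuous.
  exists (@ecirc R @` K); first by split=> // _ [x /KA[Ax _] <-].
  have mK : measurable K by exact: compact_measurable.
  have meK : measurable (@ecirc R @` K : set (zborel C)).
    rewrite -[_ @` _]setCK; apply: (@measurableC _ (zborel C)).
    by apply: sub_sigma_algebra; apply: closed_openC; exact: circle_compact_closed.
  apply: (@le_trans _ _ (lam K + e%:E)%E).
    rewrite [leLHS]circle_probE (measureDI lam mPI mK) addeC leeD//.
      by apply: le_measure; rewrite ?inE//; exact: measurableI.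
    exact: ltW.
  rewrite leeD2r// [leRHS]circle_probE.
  apply: le_measure; rewrite ?inE//.
    by apply: measurableI => //; exact: ecirc_preimage_measurable.
  by move=> x Kx; split; [exists x|case: (KA _ Kx)].
have [s _ <-] := ecirc_surj b.
have mP := ecirc_preimage_measurable mA.
set B := [set _ | _ in _].
have BE : @ecirc R @^-1` B = (fun x => x + - s) @^-1` (@ecirc R @^-1` A).
  apply/seteqP; split=> x /=.
    move=> [z Az zx]; suff -> : ecirc (x - s) = z by [].
    by apply: (addrI (ecirc s)); rewrite zx -ecircD addrC subrK.
  by move=> Ax; exists (ecirc (x - s)) => //; rewrite -ecircD addrC subrK.
have mB : measurable (@ecirc R @^-1` B).
  by rewrite BE -[X in measurable X]setTI; exact: shift_measurable.
rewrite [LHS]circle_probE [RHS]circle_probE -(lebesgue_shift s); last exact: measurableI.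
rewrite preimage_setI shift_preimage_oc BE.
rewrite (_ : _ @^-1` _ = @ecirc R @^-1` A); last first.
  by apply/seteqP; split => x /=; rewrite addrK.
rewrite !windowE//; congr (_%:E).
rewrite (_ : 1 - s = 0 - s + 1); last by rewrite sub0r addrC.
by rewrite (window_period mP (0 - s) 0 ltr01 (@ecirc_preimage_period A)) add0r.
Qed.

(** Euclid's algorithm with nearest remainders. Dividing 1 and a by a period s, either some
    remainder r is nonzero, and r or s - r is a period at most s / 2, or 1 = m s and a = l s, which
    gives the excluded m a = l. *)
Lemma small_periods (P : set R) (a : R) : 0 <= a ->
  (forall m l : nat, (0 < m)%N -> m%:R * a != l%:R) ->
  period P 1 -> period P a ->
  forall e, 0 < e -> exists2 s, 0 < s <= e & period P s.
Proof.
move=> a0 irr p1 pa.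
have half s : 0 < s -> period P s ->
    exists s', [/\ 0 < s', s' <= s / 2 & period P s'].
  move=> s0 ps.
  have rest x : 0 <= x -> period P x -> exists l : nat, x = l%:R * s \/
      exists s', [/\ 0 < s', s' <= s / 2 & period P s'].
    move=> x0 px; exists (Num.truncn (x / s)); set l := Num.truncn _.
    have lx : l%:R * s <= x by rewrite -ler_pdivlMr// Num.Theory.truncn_le divr_ge0// ltW.
    have xl : x < l.+1%:R * s by rewrite -ltr_pdivrMr// truncnS_gt.
    have [->|xls] := eqVneq x (l%:R * s); [by left|right].
    pose r := x - l%:R * s.
    have r0 : 0 < r by rewrite subr_gt0 lt_neqAle eq_sym xls.
    have rs : r < s by rewrite ltrBlDr (lt_le_trans xl)// -natr1 mulrDl mul1r addrC.
    have pr : period P r by apply: periodD => //; apply: periodN; exact: period_muln.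
    have [rh|hr] := leP r (s / 2); first by exists r.
    exists (s - r); split; [by rewrite subr_gt0|lra|].
    by apply: periodD => //; exact: periodN.
  have [m [m1|//]] := rest 1 ler01 p1.
  have [l [la|//]] := rest a a0 pa.
  have m0 : (0 < m)%N by case: m m1 => // /eqP; rewrite mul0r oner_eq0.
  have /eqP[] := irr m l m0.
  by rewrite la mulrCA -m1 mulr1.
move=> e e0.
have halves k : exists s', [/\ 0 < s', s' <= 2 ^- k & period P s'].
  elim: k => [|k [s [s0 sk ps]]]; first by exists 1; rewrite expr0 invr1.
  have [s' [s'0 s's ps']] := half s s0 ps; exists s'; split => //.
  by rewrite (le_trans s's)// exprSr invfM ler_wpM2r// invr_ge0.
have [k ke] : exists k, 2 ^- k <= e.
  exists (Num.truncn e^-1); rewrite -[leRHS]invrK lef_pV2 ?posrE ?invr_gt0 ?exprn_gt0//.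
  by rewrite (le_trans (ltW (truncnS_gt _)))// -natrX ler_nat ltn_expl.
have [s [s0 sk ps]] := halves k.
by exists s => //; rewrite s0 (le_trans sk).
Qed.

(** The preimage P of an invariant set has arbitrarily small periods, so it occupies the same
    proportion k of every interval. If k > 0, Lebesgue measure restricted to P and divided by k
    agrees with Lebesgue measure on intervals, hence on all measurable sets. *)
Lemma circle_ergodic (a : R) : 0 <= a ->
  (forall m l : nat, (0 < m)%N -> m%:R * a != l%:R) ->
  ergodic (circle_prob : probability _ R) (rotation (ecirc a)).
Proof.
move=> a0 irr A mA TA; set P := @ecirc R @^-1` A.
have mP : measurable P by exact: ecirc_preimage_measurable.
have p1 : period P 1 by exact: ecirc_preimage_period.
have pa : period P a.
  move=> x; rewrite /P /= ecircD addrC.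
  by rewrite -[X in _ <-> X]/((fun z => A z) (ecirc x)) -{2}TA.
have win y x := window_small_periods mP (small_periods a0 irr p1 pa) y (x := x).
set k := window P 0 1 in win.
have kE : circle_prob A = k%:E by rewrite circle_probE windowE.
rewrite [X in X = _ \/ X = _]kE.
have [->|k0] := eqVneq k 0; [by left|right].
have {}k0 : 0 < k by rewrite lt_neqAle eq_sym k0 window_ge0.
pose ki : {nonneg R} := NngNum (ltW (etrans (invr_gt0 k) k0)).
pose nu : {measure set (measurableTypeR R) -> \bar R} :=
  mscale ki (mrestr lam mP).
have mPI : measurable (P `&` `]0, 1]) by exact: measurableI.
(* Comparing the two measures on a piece of P itself gives k = k^-1 * k, that is k = 1. *)
have lamE : lam (P `&` `]0, 1]) = nu (P `&` `]0, 1]).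
  apply: lebesgue_measure_unique => // _ [[x y] _ <-] /=.
  rewrite [RHS](_ : _ = (k^-1%:E * lam (P `&` `]x, y]))%E); last by rewrite setIC.
  rewrite windowE//.
  have [xy|yx] := leP x y.
    rewrite -(subrK x y) addrC win ?subr_ge0// -EFinM mulrCA mulVf ?gt_eqF// mulr1.
    rewrite lebesgue_measure_itv /= lte_fin addrC subrK; case: ltP => [|yx].
      by rewrite -EFinB.
    by congr (_%:E); apply/eqP; rewrite eq_sym subr_eq0 eq_le xy yx.
  rewrite set_itv_ge ?bnd_simp -?leNgt ?ltW// measure0.
  by rewrite /window set_itv_ge ?bnd_simp -?leNgt ?ltW// setI0 measure0 mule0.
rewrite [RHS](_ : _ = (k^-1%:E * lam (P `&` `]0%R, 1%R]))%E) in lamE.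
  by move: lamE; rewrite !windowE// -/k -EFinM mulVf ?gt_eqF.
by rewrite -[in RHS](setIid P) setIAC.
Qed.

End circle_measure.

Lemma irrational_average (R : realType) n Phi (a : R) :
  equidistributed R n Phi -> 0 <= a ->
  (forall m l : nat, (0 < m)%N -> m%:R * a != l%:R) ->
  cos (pi *+ 2 * a) != 1 ->
  avg (Phi N) (fun j => cos ((n j)%:R * (pi *+ 2 * a))) @[N --> \oo] --> 0.
Proof.
move=> equi a0 irr a1.
pose chi (x : zborel (circle R)) : R[i] := ucval x.
have chi1 x : sqnorm (chi x) = 1 by exact: uc_sqnorm.
have chiD x : chi (rotation (ecirc a) x) = cis (pi *+ 2 * a) * chi x by [].
have lip (g : unit_circle R -> R) :
    (forall z w, `|g z - g w| <= chord z w) ->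
    measurable_fun setT (g : zborel (circle R) -> R).
  move=> gl; apply: (@continuous_borel_real R (zspace (circle R))).
  move=> x; apply/(@cvgrPdist_lt _ _ _ _ (nbhs_filter (x : circle R))) => e e0.
  apply/nbhs_ballP; exists e => // y; rewrite ball_metric_group /=.
  exact: le_lt_trans.
have mRe : measurable_fun setT (fun x : zborel (circle R) => complex.Re (chi x)).
  apply: lip => z w; rewrite /chord /chi; case: (ucval z) (ucval w) => [b c] [e f] /=.
  by rewrite -sqrtr_sqr ler_sqrt ?lerDl ?addr_ge0 ?sqr_ge0.
have mIm : measurable_fun setT (fun x : zborel (circle R) => complex.Im (chi x)).
  apply: lip => z w; rewrite /chord /chi; case: (ucval z) (ucval w) => [b c] [e f] /=.
  by rewrite -sqrtr_sqr ler_sqrt ?lerDr ?addr_ge0 ?sqr_ge0.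
pose nu : probability (zborel (circle R)) R := @circle_prob R.
have nuH : haar nu by exact: circle_haar.
apply: (character_average (nu := nu) (a := ecirc a) (chi := chi)) => //.
have L2chi : L2 nu chi by apply: character_L2.
have er : ergodic_rotation nu (ecirc a).
  by split=> //; [exact: circle_compact|exact: metrizable_metric_group
    |exact: circle_ergodic].
exact: (equi (circle R) nu _ er chi L2chi).
Qed.

(* The average over F of cos (n_j t) only sees the position of t in R/2piZ: a
   rational point is read in a cyclic group, an irrational one in the circle. *)
Lemma cos_average (R : realType) n Phi (t : R) :
  equidistributed R n Phi -> cos t != 1 ->
  avg (Phi N) (fun j => cos ((n j)%:R * t)) @[N --> \oo] --> 0.
Proof.
move=> equi t1.
have pi0 : 0 < (pi : R) *+ 2 by rewrite pmulrn_lgt0// pi_gt0.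
wlog t0 : t t1 / 0 <= t.
  move=> W; have [t0|/ltW t0] := leP 0 t; first exact: W.
  have := W (- t); rewrite cosN oppr_ge0 => /(_ t1 t0).
  apply: cvg_trans; apply: near_eq_cvg; apply: nearW => N.
  by congr (_ * _); apply: eq_bigr => j _; rewrite mulrN cosN.
pose a := t / (pi *+ 2).
have tE : t = pi *+ 2 * a by rewrite mulrC divfK ?gt_eqF.
have a0 : 0 <= a by rewrite divr_ge0// ltW.
have [irr|] := pselect (forall m l : nat, (0 < m)%N -> m%:R * a != l%:R).
  by rewrite tE; apply: irrational_average => //; rewrite -tE.
move=> /existsNP[[|q] /existsNP[l /not_implyP[//_ /negP]]].
rewrite negbK => /eqP qa; apply: (rational_average (q := q)) => //.
rewrite tE mulrCA qa mulrC; elim: l {qa} => [|l IH]; first by rewrite mul0r cis0.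
by rewrite -natr1 mulrDl mul1r cisD IH mul1r /cis cos2pi sin2pi.
Qed.

(** * Trigonometric polynomials *)

Section trigonometric_polynomials.
Variable R : realType.
Implicit Types (s : seq (R * nat)) (t : R).

(* A list of pairs (coefficient, exponent) encodes a polynomial; it is evaluated
   at the point [cis t] of the unit circle and at Koopman operators. *)
Definition circle_eval s t : R[i] := \sum_(p <- s) p.1%:C%C * cis (p.2%:R * t).

Definition koopman_eval (X : Type) (T : X -> X) s (f : X -> R) (x : X) : R :=
  \sum_(p <- s) p.1 * f (iter p.2 T x).

Definition sub_coefs s1 s2 := s1 ++ [seq (- p.1, p.2) | p <- s2].

Lemma circle_eval_sub s1 s2 t :
  circle_eval (sub_coefs s1 s2) t = circle_eval s1 t - circle_eval s2 t.
Proof.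
rewrite /circle_eval big_cat /= big_map -sumrN; congr (_ + _).
by apply: eq_bigr => p _; rewrite /= rmorphN mulNr.
Qed.

Lemma koopman_eval_sub (X : Type) (T : X -> X) s1 s2 f x :
  koopman_eval T (sub_coefs s1 s2) f x =
  koopman_eval T s1 f x - koopman_eval T s2 f x.
Proof.
rewrite /koopman_eval big_cat /= big_map -sumrN; congr (_ + _).
by apply: eq_bigr => p _; rewrite /= mulNr.
Qed.

(** Subsets F with equal sums keep separate entries, which produces the multiplicities. *)
Definition ip_coefs (A : {fset nat}) (n : nat -> nat) : seq (R * nat) :=
  [seq ((2 ^+ #|` A|)^-1, (\sum_(j <- F) n j)%N) | F : {fset nat} <- fpowerset A].

Definition cesaro_coefs (N : nat) : seq (R * nat) :=
  [seq (N%:R^-1, k) | k <- iota 0 N].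

Lemma koopman_eval_ip (X : Type) (T : X -> X) A n f x :
  koopman_eval T (ip_coefs A n) f x = IPavg A n (fun k => f (iter k T x)).
Proof. by rewrite /koopman_eval big_map /IPavg mulr_sumr. Qed.

Lemma cis_sum (I : Type) (r : seq I) (m : I -> nat) t :
  cis ((\sum_(j <- r) m j)%N%:R * t) = \prod_(j <- r) cis ((m j)%:R * t).
Proof.
elim: r => [|i r IH]; first by rewrite !big_nil mul0r cis0.
by rewrite !big_cons natrD mulrDl cisD IH.
Qed.

Lemma sum_fpowerset (A : {fset nat}) (n : nat -> nat) t :
  \sum_(F <- fpowerset A) cis ((\sum_(j <- F) n j)%N%:R * t) =
  \prod_(j <- A) (1 + cis ((n j)%:R * t)).
Proof.
(* Subsets of A are read as sets over the finite type of its elements, where [bigA_distr] expands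
   the product. *)
rewrite /fpowerset big_imfset /=; last first.
  by move=> X Y _ _ /fsetP eqXY; apply/setP => x; have := eqXY (val x); rewrite !inE.
rewrite [RHS]big_seq_fsetE /=.
under [RHS]eq_bigr do rewrite addrC.
rewrite bigA_distr big_enum /=; apply: eq_big => [J|J _].
  by rewrite powersetE finset.subsetT.
rewrite cis_sum big_imfset /=; last by move=> i j _ _; exact: val_inj.
by rewrite big_enum /= big_mkcond.
Qed.

Lemma ip_sqnorm (A : {fset nat}) (n : nat -> nat) t :
  sqnorm (circle_eval (ip_coefs A n) t) =
  \prod_(j <- A) ((1 + cos ((n j)%:R * t)) / 2).
Proof.
rewrite /circle_eval big_map /= -mulr_sumr sum_fpowerset.
have -> : ((2 ^+ #|` A|)^-1)%:C%C = \prod_(j <- A) (2^-1)%:C%C :> R[i].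
  by rewrite big_const_seq count_predT iter_mulr_1 -exprVn rmorphXn.
rewrite -big_split /=; have sq1 : sqnorm (1 : R[i]) = 1 by rewrite -(cis_sqnorm 0) cis0.
rewrite (big_morph (@sqnorm R) (@sqnormM R) sq1); apply: eq_bigr => j _.
rewrite sqnormM /sqnorm /= expr0n addr0 /= add0r.
set c := cos _; set s := sin _.
have -> : s ^+ 2 = 1 - c ^+ 2 by rewrite -(cos2Dsin2 ((n j)%:R * t)) addrC addKr.
by field.
Qed.

Local Notation normc := (@Normc.normc R).

Lemma normc_ge0 (z : R[i]) : 0 <= normc z.
Proof. by case: z => a b; rewrite sqrtr_ge0. Qed.

Lemma sqnormE (z : R[i]) : sqnorm z = normc z ^+ 2.
Proof. by case: z => a b; rewrite /= sqr_sqrtr// addr_ge0 ?sqr_ge0. Qed.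

Lemma normcE (z : R[i]) : normc z = Num.sqrt (sqnorm z).
Proof. by rewrite sqnormE sqrtr_sqr ger0_norm// normc_ge0. Qed.

Lemma normc_cis t : normc (cis t) = 1.
Proof. by rewrite normcE cis_sqnorm sqrtr1. Qed.

Lemma normcR (c : R) : normc c%:C%C = `|c|.
Proof. by rewrite /= expr0n addr0 sqrtr_sqr. Qed.

Lemma normc_sum (I : Type) (r : seq I) (F : I -> R[i]) :
  normc (\sum_(i <- r) F i) <= \sum_(i <- r) normc (F i).
Proof.
elim: r => [|i r IH]; first by rewrite !big_nil Normc.normc0.
by rewrite !big_cons (le_trans (le_normcD _ _))// lerD2l.
Qed.

(** The l1 norm of the coefficients bounds the polynomial on the whole circle; it supplies the
    uniform bound for bounded convergence. *)
Definition abs_coefs s : R := \sum_(p <- s) `|p.1|.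

Lemma abs_coefs_sub s1 s2 :
  abs_coefs (sub_coefs s1 s2) = abs_coefs s1 + abs_coefs s2.
Proof.
rewrite /abs_coefs big_cat big_map /=; congr (_ + _).
by apply: eq_bigr => p _; rewrite normrN.
Qed.

Lemma abs_coefs_ip A n : abs_coefs (ip_coefs A n) = 1.
Proof.
rewrite /abs_coefs big_map /= big_const_seq count_predT iter_addr_0.
have -> : size (fpowerset A) = (2 ^ #|` A|)%N by rewrite -card_fpowerset.
by rewrite ger0_norm// -[_ *+ (2 ^ _)%N]mulr_natr natrX mulVf// expf_neq0// pnatr_eq0.
Qed.

(** An inequality, because the list is empty for N = 0. *)
Lemma abs_coefs_cesaro N : abs_coefs (cesaro_coefs N) <= 1.
Proof.
rewrite /abs_coefs big_map /= big_const_seq count_predT iter_addr_0 size_iota.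
rewrite ger0_norm ?invr_ge0// -[_^-1 *+ _]mulr_natr.
case: N => [|N]; first by rewrite mulr0n mulr0.
by rewrite mulVf// pnatr_eq0.
Qed.

Lemma circle_eval_le s t : normc (circle_eval s t) <= abs_coefs s.
Proof.
rewrite (le_trans (normc_sum _ _))// ler_sum// => p _.
by rewrite Normc.normcM normcR normc_cis mulr1.
Qed.

Lemma cis_muln t k : cis (k%:R * t) = cis t ^+ k.
Proof.
elim: k => [|k IH]; first by rewrite mul0r cis0.
by rewrite -natr1 mulrDl mul1r cisD IH exprSr.
Qed.

Lemma cos1_cis t : cos t = 1 -> cis t = 1.
Proof.
move=> ct; have := cos2Dsin2 t; rewrite ct expr1n -[RHS]addr0 => /addrI/eqP.
by rewrite sqrf_eq0 => /eqP st; rewrite /cis ct st.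
Qed.

Lemma circle_eval_one s t : cos t = 1 ->
  circle_eval s t = (\sum_(p <- s) p.1)%:C%C.
Proof.
move=> /cos1_cis ct; rewrite rmorph_sum; apply: eq_bigr => p _.
by rewrite cis_muln ct expr1n mulr1.
Qed.

Lemma ip_eval_one A n t : cos t = 1 -> circle_eval (ip_coefs A n) t = 1.
Proof.
move=> ct; rewrite circle_eval_one//; congr (_%:C%C); rewrite -(abs_coefs_ip A n).
by rewrite /abs_coefs !big_map /=; apply: eq_bigr => F _; rewrite ger0_norm.
Qed.

Lemma cesaro_eval_one N t : (0 < N)%N -> cos t = 1 ->
  circle_eval (cesaro_coefs N) t = 1.
Proof.
move=> N0 ct; rewrite circle_eval_one//; congr (_%:C%C).
rewrite big_map /= big_const_seq count_predT iter_addr_0 size_iota -[_^-1 *+ _]mulr_natr.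
by rewrite mulVf// pnatr_eq0 -lt0n.
Qed.

(** The geometric sum is at most 2 / |cis t - 1| in modulus for every N, and is then divided by
    N. *)
Lemma cesaro_eval_cvg0 t : cos t != 1 ->
  normc (circle_eval (cesaro_coefs N) t) @[N --> \oo] --> 0.
Proof.
move=> t1; pose d := normc (cis t - 1).
have d0 : 0 < d.
  rewrite lt_neqAle normc_ge0 andbT eq_sym; apply/eqP => /Normc.eq0_normc.
  by case=> /eqP; rewrite subr_eq0 (negbTE t1).
have bnd N : normc (circle_eval (cesaro_coefs N) t) <= 2 / d * N%:R^-1.
  rewrite /circle_eval big_map /= -mulr_sumr Normc.normcM normcR.
  rewrite ger0_norm ?invr_ge0// mulrC ler_wpM2r ?invr_ge0// ler_pdivlMr//.
  rewrite -Normc.normcM mulrC.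
  under eq_bigr do rewrite cis_muln.
  have -> : iota 0 N = index_iota 0 N by rewrite /index_iota subn0.
  rewrite big_mkord -subrX1.
  by rewrite (le_trans (le_normcD _ _))// normcN -cis_muln normc_cis Normc.normc1.
apply: (squeeze_cvgr (f := fun=> 0) (h := fun N => 2 / d * N%:R^-1)).
- by apply: nearW => N; rewrite normc_ge0 bnd.
- exact: cvg_cst.
- rewrite -[X in _ --> X](mulr0 (2 / d)); apply: cvgMr => //.
  by rewrite -cvg_shiftS; exact: cvg_harmonic.
Qed.

End trigonometric_polynomials.

(** * Decay of the IP polynomials away from 1 *)

Section decay.
Variables (R : realType) (n : nat -> nat) (Phi : nat -> {fset nat}).
Local Notation normc := (@Normc.normc R).

(* The largest element of A makes [A + 1] and [A] differ. *)
Lemma symdiff_shift_gt0 (A : {fset nat}) : A != fset0 ->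
  (0 < #|` symdiff [fset (1 + j)%N | j in A]%fset A|)%N.
Proof.
move=> /fset0Pn[a aA]; rewrite cardfs_gt0; apply/fset0Pn; apply/not_existsP => nos.
have AS j : j \in A -> j.+1 \in A.
  move=> jA; apply: contraT => jnA; exfalso; apply: (nos j.+1).
  rewrite /symdiff in_fsetU !in_fsetD (negbTE jnA) /=.
  by apply/orP; left; apply/imfsetP; exists j.
have Ak k : (a + k)%N \in A.
  by elim: k => [|k IH]; rewrite ?addn0// addnS AS.
have := @leq_bigmax_seq nat (enum_fset A) xpredT id _ (Ak (\max_(j <- A) j).+1) isT.
by rewrite addnS ltnNge leq_addl.
Qed.

(** For the shift by 1 the numerator of the Folner ratio is at least 1, so the ratio dominates the
    inverse cardinal. *)
Lemma Folner_card : Folner R Phi -> (#|` Phi N|%:R^-1 : R) @[N --> \oo] --> 0.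
Proof.
move=> [Phi0 /(_ 1%N isT) PhiF]; apply: squeeze_cvgr (cvg_cst 0) PhiF.
near=> N; have N0 : (0 < N)%N by near: N; exists 1%N.
have [PN0 _] := Phi0 N N0; rewrite invr_ge0 ler0n/= ler_peMl ?invr_ge0//.
by rewrite ler1n symdiff_shift_gt0.
Unshelve. all: by end_near. Qed.

Hypotheses (PhiF : Folner R Phi) (equi : equidistributed R n Phi).

Lemma ip_eval_cvg0 (t : R) : cos t != 1 ->
  normc (circle_eval (ip_coefs R (Phi N) n) t) @[N --> \oo] --> 0.
Proof.
move=> t1; have cavg := cos_average equi t1.
have card0 := Folner_card PhiF.
suff prod0 : \prod_(j <- Phi N) ((1 + cos ((n j)%:R * t)) / 2)
    @[N --> \oo] --> (0 : R).
  under eq_cvg do rewrite normcE ip_sqnorm.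
  have : Num.sqrt (\prod_(j <- Phi N) ((1 + cos ((n j)%:R * t)) / 2))
      @[N --> \oo] --> Num.sqrt (0 : R).
    by apply: continuous_cvg => //; exact: sqrt_continuous.
  by rewrite sqrtr0.
(* If the cosines average at most 1/2, the terms (1 - cos) / 2 sum to at least |A| / 4, so the
   product is at most exp (- |A| / 4), and exp x >= 1 + x turns this into 4 / |A|. *)
have bnd (A : {fset nat}) : A != fset0 ->
    avg A (fun j => cos ((n j)%:R * t)) <= 2^-1 ->
    \prod_(j <- A) ((1 + cos ((n j)%:R * t)) / 2) <= 4 * #|` A|%:R^-1.
  move=> A0 hA; have cA : 0 < #|` A|%:R :> R by rewrite ltr0n cardfs_gt0.
  apply: (@le_trans _ _ (\prod_(j <- A) expR (- ((1 - cos ((n j)%:R * t)) / 2)))).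
    apply: ler_prod => j _; have c1 := cos_geN1 ((n j)%:R * t).
    apply/andP; split; first by lra.
    by apply: le_trans (expR_ge1Dx _); lra.
  rewrite -expR_sum sumrN expRN -[leRHS]invrK lef_pV2 ?posrE ?expR_gt0//; last first.
    by rewrite invr_gt0 mulr_gt0// invr_gt0.
  apply: le_trans (expR_ge1Dx _); rewrite invfM invrK.
  rewrite /avg ler_pdivrMl// in hA.
  rewrite -mulr_suml sumrB big_const_seq count_predT iter_addr_0 -[#|` A|]/(size A) in hA *.
  move: cA hA; rewrite -[1 *+ size A]/(size A)%:R.
  set S := \sum_(_ <- _) _; set c := (size A)%:R; lra.
have : 4 * (#|` Phi N|%:R^-1 : R) @[N --> \oo] --> 4 * (0 : R) by exact: cvgMr.
rewrite mulr0; apply: squeeze_cvgr (cvg_cst 0).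
have half : \forall N \near \oo, avg (Phi N) (fun j => cos ((n j)%:R * t)) <= 2^-1.
  move/cvgrPdist_le : cavg => /(_ 2^-1).
  rewrite invr_gt0 ltr0n => /(_ isT); apply: filterS => N.
  by rewrite sub0r normrN => /(le_trans (ler_norm _)).
near=> N; have N0 : (0 < N)%N by near: N; exists 1%N.
rewrite prodr_ge0 /=.
  by apply: bnd; [exact: (PhiF.1 N N0).1|near: N].
move=> j _; have := cos_geN1 ((n j)%:R * t); lra.
Unshelve. all: by end_near. Qed.

End decay.

(** * Bounded convergence for positive functionals *)

Section bounded_convergence.
Variables (R : realType) (K : set R).
Hypothesis cK : compact K.

Lemma continuous_minr (f g : R -> R) : continuous f -> continuous g ->
  continuous (fun x => Num.min (f x) (g x)).
Proof.
move=> cf cg.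
rewrite (_ : (fun x => _) = fun x => (f x + g x - `|f x - g x|) / 2); last first.
  by apply/funext => x; rewrite minr_absE.
move=> x; apply: cvgMl; apply: cvgB.
  by apply: cvgD; [exact: cf|exact: cg].
by apply: cvg_norm; apply: cvgB; [exact: cf|exact: cg].
Qed.

Lemma continuous_maxr (f g : R -> R) : continuous f -> continuous g ->
  continuous (fun x => Num.max (f x) (g x)).
Proof.
move=> cf cg.
rewrite (_ : (fun x => _) = fun x => (f x + g x + `|f x - g x|) / 2); last first.
  by apply/funext => x; rewrite maxr_absE.
move=> x; apply: cvgMl; apply: cvgD.
  by apply: cvgD; [exact: cf|exact: cg].
by apply: cvg_norm; apply: cvgB; [exact: cf|exact: cg].
Qed.

(** The open sets where g n < e increase with n and cover K, so one of them contains K. *)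
Lemma dini (g : nat -> R -> R) e : (forall n, continuous (g n)) ->
  (forall n x, g n.+1 x <= g n x) ->
  (forall x, K x -> exists n, g n x < e) ->
  exists N, forall n x, (N <= n)%N -> K x -> g n x < e.
Proof.
move=> cg dg ge; move: cK; rewrite compact_cover => cov.
have [|x Kx|D _ KD] := cov nat setT (fun n => [set x | g n x < e]).
- move=> n _; have /continuousP/(_ _ (@open_lt R e)) := cg n.
  by [].
- by have [n gn] := ge x Kx; exists n.
exists (\max_(i <- D) i)%N => n x Dn /KD[i iD gi]; apply: le_lt_trans gi.
have homo m k : (m <= k)%N -> g k x <= g m x.
  move=> /subnK <-; elim: (k - m)%N => [|j IH]; first by rewrite add0n.
  by rewrite addSn (le_trans (dg _ _)).
apply: homo; apply: leq_trans Dn.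
exact: (@leq_bigmax_seq nat (enum_fset D) xpredT id _ iD isT).
Qed.

Variable L : (R -> R) -> R.
Hypothesis LD : forall f g : R -> R, continuous f -> continuous g ->
  L (fun x => f x + g x) = L f + L g.
Hypothesis LZ : forall (c : R) (f : R -> R), continuous f -> L (fun x => c * f x) = c * L f.
Hypothesis L_ge0 : forall f : R -> R, continuous f -> (forall x, K x -> 0 <= f x) -> 0 <= L f.

Lemma le_L (f g : R -> R) : continuous f -> continuous g ->
  (forall x, K x -> f x <= g x) -> L f <= L g.
Proof.
move=> cf cg fg; rewrite -subr_ge0 -mulN1r -LZ// -LD//; last first.
  by move=> x; apply: cvgMr; exact: cf.
apply: L_ge0 => [x|x Kx]; last by rewrite mulN1r subr_ge0 fg.
by apply: cvgD; [exact: cg|apply: cvgMr; exact: cf].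
Qed.

Lemma L_le_cst (f : R -> R) c : continuous f -> (forall x, K x -> f x <= c) ->
  L f <= c * L (fun=> 1).
Proof.
move=> cf fc; rewrite -LZ; last by move=> x; exact: cvg_cst.
apply: le_L => // [x|x Kx]; first exact: cvg_cst.
by rewrite mulr1 fc.
Qed.

Lemma L_minmax (f g : R -> R) : continuous f -> continuous g ->
  L (fun x => Num.min (f x) (g x)) + L (fun x => Num.max (f x) (g x)) = L f + L g.
Proof.
move=> cf cg; rewrite -!LD//; [|exact: continuous_minr|exact: continuous_maxr].
by congr L; apply/funext => x; rewrite addr_min_max.
Qed.

Variables (h : nat -> R -> R) (C : R).
Hypothesis ch : forall n, continuous (h n).
Hypothesis h0 : forall n x, 0 <= h n x.
Hypothesis hC : forall n x, h n x <= C.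
Hypothesis hcvg : forall x, K x -> h N x @[N --> \oo] --> 0.

(* That is, c <= sup_(k >= n) h k pointwise. *)
Definition below_tail (n : nat) (c : R -> R) := [/\ continuous c,
  forall x, 0 <= c x &
  forall x d, (forall k, (n <= k)%N -> h k x <= d) -> c x <= d].

Lemma below_tail_max n f g : below_tail n f -> below_tail n g ->
  below_tail n (fun x => Num.max (f x) (g x)).
Proof.
move=> [cf f0 ft] [cg g0 gt]; split; first exact: continuous_maxr.
- by move=> x; rewrite le_max f0.
- by move=> x d hd; rewrite ge_max ft// gt.
Qed.

Lemma below_tail_min n m f g : below_tail n f -> below_tail m g ->
  below_tail m (fun x => Num.min (f x) (g x)).
Proof.
move=> [cf f0 ft] [cg g0 gt]; split; first exact: continuous_minr.
- by move=> x; rewrite le_min f0 g0.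
- by move=> x d hd; rewrite ge_min (gt x d)// orbT.
Qed.

Lemma below_tailS n f : below_tail n.+1 f -> below_tail n f.
Proof.
move=> [cf f0 ft]; split=> // x d hd; apply: ft => k nk.
by apply: hd; exact: ltnW.
Qed.

Lemma below_tail_h n k : (n <= k)%N -> below_tail n (h k).
Proof. by move=> nk; split=> // x d; exact. Qed.

(** [sup (S n)] stands in for the integral of sup_(k >= n) h k, a function that may fail to be
    continuous and then escapes the hypotheses on [L]. *)
Let S n := [set L c | c in below_tail n].

Lemma below_tail_has_sup n : has_sup (S n).
Proof.
split; first by exists (L (h n)), (h n) => //; exact: below_tail_h.
exists (C * L (fun=> 1)) => _ [c [cc c0 ct] <-]; apply: L_le_cst => // x _.
by apply: ct => k _; exact: hC.
Qed.

Lemma L_le_sup n c : below_tail n c -> L c <= sup (S n).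
Proof.
by move=> bc; apply: ub_le_sup; [case: (below_tail_has_sup n)|exists c].
Qed.

(** Near-maximisers c n of S n need not decrease, so Dini's argument is applied to their running
    minima g n. The errors e / 2^(n+1) are summable, which keeps L (g n) within e of [sup (S n)]. *)
Lemma bounded_convergence : L (h N) @[N --> \oo] --> 0.
Proof.
pose L1 := L (fun=> 1).
have L10 : 0 <= L1 by apply: L_ge0 => // x; exact: cvg_cst.
suff key e : 0 < e -> exists N, forall n, (N <= n)%N -> sup (S n) <= e * (1 + L1).
  apply/cvgrPdist_le => e e0.
  have [|N HN] := key (e / (1 + L1)); first by rewrite divr_gt0// ltr_wpDr.
  exists N => // n /= Nn; rewrite sub0r normrN ger0_norm ?L_ge0//.
  rewrite (le_trans (L_le_sup (below_tail_h (leqnn n))))//.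
  by rewrite (le_trans (HN n Nn))// divfK// gt_eqF// ltr_wpDr.
move=> e0.
have adm n : exists c, below_tail n c /\ sup (S n) - e / 2 ^+ n.+1 < L c.
  have en : 0 < e / 2 ^+ n.+1 by rewrite divr_gt0// exprn_gt0.
  by have [_ [c bc <-] Lc] := sup_adherent en (below_tail_has_sup n); exists c.
have [c cP] := choice adm.
pose g := fix g n := if n is m.+1 then (fun x => Num.min (g m x) (c m.+1 x)) else c 0%N.
have gb n : below_tail n (g n).
  elim: n => [|n IH]; first exact: (cP 0%N).1.
  exact: below_tail_min IH (cP n.+1).1.
(* For the step from n to n + 1, [L_minmax] bounds the loss: the maximum of g n and c (n+1) is still
   below the tail from n, so its L is at most [sup (S n)], and this term cancels against the
   induction hypothesis. *)
have gL n : sup (S n) - e * (1 - (2 ^+ n.+1)^-1) <= L (g n).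
  elim: n => [|n IH].
    have [_ /ltW] := cP 0%N; apply: le_trans.
    by rewrite expr1 lerD2l lerN2; rewrite le_eqVlt; apply/orP; left; apply/eqP; field.
  have [bc Lc] := cP n.+1.
  have := L_le_sup (below_tail_max (gb n) (below_tailS bc)).
  have [[cgn _ _] [cc _ _]] := (gb n, bc); have := L_minmax cgn cc.
  move: IH Lc => /=; rewrite ![2 ^+ n.+2]exprS !invfM.
  set u := (2 ^+ n.+1)^-1; lra.
have [N HN] : exists N, forall n x, (N <= n)%N -> K x -> g n x < e.
  apply: dini => [n|n x|x Kx].
  - by case: (gb n).
  - by rewrite /= ge_min lexx.
  - have /cvgrPdist_lt/(_ (e / 2)) := hcvg Kx.
    rewrite divr_gt0// => /(_ isT)[n _ Hn]; exists n.
    apply: (@le_lt_trans _ _ (e / 2)); last by lra.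
    have [_ _ gt] := gb n; apply: gt => k nk.
    by have := Hn k nk; rewrite /= sub0r normrN => /ltW; apply: le_trans (ler_norm _).
exists N => n Nn; have [cgn _ _] := gb n.
have := gL n; have : L (g n) <= e * L1.
  by apply: L_le_cst => // x Kx; exact/ltW/HN.
have : 0 <= e * (2 ^+ n.+1)^-1 by rewrite mulr_ge0 ?invr_ge0 ?exprn_ge0// ltW.
lra.
Qed.

End bounded_convergence.

(** * The spectral functional of a positive definite sequence *)

Section ultralimit.
Variable R : realType.

(** Such an ultrafilter gives all bounded sequences limits at once and linearly, so no subsequence
    is chosen per test function; refining [\oo], it preserves ordinary limits. *)
Lemma ultrafilter_nat : exists U : set_system nat, UltraFilter U /\ \oo `<=` U.
Proof. exact: ultraFilterLemma. Qed.

(** The image of U under u is an ultrafilter containing the compact interval [-B, B]. *)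
Lemma cvg_ultra (U : set_system nat) (u : nat -> R) (B : R) : UltraFilter U ->
  (forall N, `|u N| <= B) -> cvg (u N @[N --> U]).
Proof.
move=> UU uB; have UP : ProperFilter U by exact: ultra_proper.
have uU : UltraFilter (u N @[N --> U]).
  split=> [|G GP uG]; first exact: fmap_proper_filter.
  apply/seteqP; split=> // A GA.
  have [//|UA] := in_ultra_setVsetC (u @^-1` A) UU.
  have GC : G (~` A) by apply: uG.
  by have [x []] := filter_ex (filterI GA GC).
have := @segment_compact R (- B) B; rewrite compact_ultra => /(_ _ uU)[|l [_ ul]].
  by apply: nearW => N; rewrite /= in_itv /= -ler_norml.
by apply/cvg_ex; exists l.
Qed.

End ultralimit.

(** * Orthogonality of cosines over roots of unity *)

Section discrete_orthogonality.
Variable R : realType.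

(** Angles of the Q-th roots of unity. Averaging over them integrates cos (j t) exactly for j < Q,
    so finite sums replace integrals over the circle. *)
Definition grid (Q q : nat) : R := pi *+ 2 * (q%:R / Q%:R).

Lemma cos_lt1 (x : R) : 0 < x < pi *+ 2 -> cos x < 1.
Proof.
move=> /andP[x0 x2]; have s0 : 0 < sin (x / 2).
  by apply: sin_gt0_pi; rewrite divr_gt0//= ltr_pdivrMr// mulr_natr.
have -> : x = (x / 2) *+ 2 by rewrite -mulr_natr divfK// pnatr_eq0.
rewrite cos_mulr2n; have := cos2Dsin2 (x / 2); move: s0.
set s := sin _; set c := cos _ => s0; have := mulr_gt0 s0 s0.
rewrite -expr2 -mulr_natr; lra.
Qed.

Lemma grid_average (Q j : nat) : (j < Q)%N ->
  Q%:R^-1 * \sum_(q < Q) cos (j%:R * grid Q q) = (j == 0%N)%:R.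
Proof.
move=> jQ; have Q0 : (0 < Q)%N by exact: leq_ltn_trans jQ.
have QN0 : Q%:R != 0 :> R by rewrite pnatr_eq0 -lt0n.
have [->|j0] := eqVneq j 0%N.
  under eq_bigr do rewrite mul0r cos0.
  by rewrite sumr_const card_ord mulVf.
pose x : R := pi *+ 2 * (j%:R / Q%:R).
have E q : j%:R * grid Q q = q%:R * x by rewrite /grid /x; field.
have x1 : cos x < 1.
  apply: cos_lt1; have pi0 : 0 < pi *+ 2 :> R by rewrite pmulrn_lgt0// pi_gt0.
  apply/andP; split; first by rewrite mulr_gt0// divr_gt0// ltr0n// lt0n.
  rewrite /x -[X in _ < X]mulr1 ltr_pM2l//.
  by rewrite ltr_pdivrMr ?ltr0n// mul1r ltr_nat.
have zQ : cis x ^+ Q = 1.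
  rewrite -cis_muln (_ : Q%:R * x = j%:R * (pi *+ 2)); last by rewrite /x; field.
  by rewrite cis_muln /cis cos2pi sin2pi expr1n.
have : (cis x - 1) * \sum_(q < Q) cis x ^+ q = 0 by rewrite -subrX1 zQ subrr.
move/eqP; rewrite mulf_eq0 => /orP[/eqP z1|/eqP s0].
  by move: x1; rewrite -subr_lt0; case: z1 => ->; rewrite ltxx.
have -> : \sum_(q < Q) cos (j%:R * grid Q q) = complex.Re (\sum_(q < Q) cis x ^+ q).
  by rewrite Re_sum; apply: eq_bigr => q _; rewrite E -cis_muln.
by rewrite s0 mulr0.
Qed.

End discrete_orthogonality.

(** * Fejer sums of a positive definite sequence and their ultralimit *)

Section spectral_functional.
Variables (R : realType) (c : nat -> R).

Definition natdist (k l : nat) : nat := (k - l + (l - k))%N.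

Lemma natdistC k l : natdist k l = natdist l k.
Proof. by rewrite /natdist addnC. Qed.

Lemma natdistE (k l : nat) (t : R) : cos ((natdist k l)%:R * t) =
  cos (k%:R * t) * cos (l%:R * t) + sin (k%:R * t) * sin (l%:R * t).
Proof.
rewrite -cosB -mulrBl /natdist; have [kl|lk] := leqP k l.
  by rewrite (eqP kl) add0n natrB// -cosN -mulNr opprB.
by rewrite (eqP (ltnW lk)) addn0 natrB// ltnW.
Qed.

Hypothesis pd : forall M (a : nat -> R),
  0 <= \sum_(k < M) \sum_(l < M) a k * a l * c (natdist k l).

(** The M-th Fejer mean of the cosine series of c: grouping the terms by k - l damps frequency m by
    the factor (M - m) / M. *)
Definition fejer_weight M t : R := M%:R^-1 *
  \sum_(k < M) \sum_(l < M) c (natdist k l) * cos ((natdist k l)%:R * t).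

(** The addition formula splits the sum into two instances of [pd], for the sequences cos (k t) and
    sin (k t). *)
Lemma fejer_weight_ge0 M t : 0 <= fejer_weight M t.
Proof.
rewrite mulr_ge0 ?invr_ge0//.
have -> : \sum_(k < M) \sum_(l < M) c (natdist k l) * cos ((natdist k l)%:R * t) =
    \sum_(k < M) \sum_(l < M) cos (k%:R * t) * cos (l%:R * t) * c (natdist k l) +
    \sum_(k < M) \sum_(l < M) sin (k%:R * t) * sin (l%:R * t) * c (natdist k l).
  rewrite -big_split /=; apply: eq_bigr => k _.
  rewrite -big_split /=; apply: eq_bigr => l _.
  by rewrite natdistE mulrC mulrDl.
by rewrite addr_ge0// (pd M (fun k => _ (k%:R * t))).
Qed.

(** Integration against the Fejer weight. The weight times cos (m t) with m < M only has frequencies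
    below 2 M, so a grid of 2 M points integrates it exactly. *)
Definition grid_functional M (h : R -> R) : R := (M.*2)%:R^-1 *
  \sum_(q < M.*2) h (grid R M.*2 q) * fejer_weight M (grid R M.*2 q).

Lemma grid_functionalD M f g : grid_functional M (fun x => f x + g x) =
  grid_functional M f + grid_functional M g.
Proof.
rewrite -mulrDr -big_split; congr (_ * _); apply: eq_bigr => q _.
by rewrite /= mulrDl.
Qed.

Lemma grid_functionalZ M a f : grid_functional M (fun x => a * f x) =
  a * grid_functional M f.
Proof.
rewrite /grid_functional [RHS]mulrCA [X in _ = _ * X]mulr_sumr; congr (_ * _).
apply: eq_bigr => q _. by rewrite /= -mulrA.
Qed.

Lemma grid_in M q : (q < M)%N -> grid R M q \in `[0, pi *+ 2].
Proof.
move=> qM; have pi0 : 0 < pi *+ 2 :> R by rewrite pmulrn_lgt0// pi_gt0.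
have M0 : 0 < M%:R :> R by rewrite ltr0n (leq_ltn_trans _ qM).
rewrite in_itv /= /grid; apply/andP; split.
  by rewrite mulr_ge0 ?divr_ge0 ?(ltW pi0).
by rewrite -[X in _ <= X]mulr1 ler_pM2l// ler_pdivrMr// mul1r ler_nat ltnW.
Qed.

Lemma le_grid_functional M f g : (forall x, x \in `[0, pi *+ 2] -> f x <= g x) ->
  grid_functional M f <= grid_functional M g.
Proof.
move=> fg; rewrite ler_wpM2l ?invr_ge0// ler_sum// => q _.
by rewrite ler_wpM2r ?fejer_weight_ge0// fg// grid_in.
Qed.

(* The sine terms cancel by exchanging k and l. *)
Lemma grid_functional_cos M m : (m < M)%N ->
  grid_functional M (fun t => cos (m%:R * t)) = (M - m)%:R / M%:R * c m.
Proof.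
move=> mM.
have shiftE t : \sum_(k < M) \sum_(l < M) c (natdist k l) * cos ((natdist k l)%:R * t) *
      cos (m%:R * t) =
    \sum_(k < M) \sum_(l < M) c (natdist k l) * cos ((natdist (m + k) l)%:R * t).
  pose A k l := c (natdist k l) * (cos (k%:R * t) * sin (l%:R * t) * sin (m%:R * t)).
  have A0 : \sum_(k < M) \sum_(l < M) (A k l - A l k) = 0.
    under eq_bigr do rewrite sumrB.
    by rewrite sumrB [X in _ - X]exchange_big subrr.
  rewrite -[LHS]addr0 -[X in _ + X = _]A0 -big_split; apply: eq_bigr => k _ /=.
  rewrite -big_split; apply: eq_bigr => l _ /=.
  by rewrite /A (natdistC l k) !natdistE natrD mulrDl cosD sinD; ring.
have -> : grid_functional M (fun t => cos (m%:R * t)) =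
    M%:R^-1 * \sum_(k < M) \sum_(l < M) c (natdist k l) *
      ((M.*2)%:R^-1 * \sum_(q < M.*2) cos ((natdist (m + k) l)%:R * grid R M.*2 q)).
  rewrite /grid_functional /fejer_weight.
  transitivity ((M.*2)%:R^-1 * \sum_(q < M.*2) M%:R^-1 * \sum_(k < M) \sum_(l < M)
      c (natdist k l) * cos ((natdist (m + k) l)%:R * grid R M.*2 q)).
    congr (_ * _); apply: eq_bigr => q _; rewrite mulrCA -shiftE. congr (_ * _).
    rewrite mulr_sumr; apply: eq_bigr => k _; rewrite mulr_sumr.
    by apply: eq_bigr => l _; rewrite mulrC.
  rewrite -mulr_sumr mulrCA; congr (_ * _); rewrite exchange_big mulr_sumr.
  apply: eq_bigr => k _; rewrite exchange_big mulr_sumr; apply: eq_bigr => l _ /=.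
  by rewrite -mulr_sumr mulrCA.
rewrite mulrAC [RHS]mulrC; congr (_ * _).
(* By orthogonality only l = m + k survives, and this is an admissible index for exactly M - m
   values of k. *)
transitivity (\sum_(k < M) if (m + k < M)%N then c m else 0).
  apply: eq_bigr => k _; have kM := ltn_ord k.
  under eq_bigr => l _.
    rewrite grid_average; last by have := ltn_ord l; rewrite /natdist -addnn; lia.
    over.
  case: ifP => mk; last first.
    rewrite big1// => l _; have := ltn_ord l.
    case: eqP => [nd lM|_ _]; last by rewrite mulr0.
    by exfalso; move: nd lM mk; rewrite /natdist; lia.
  rewrite (bigD1 (Ordinal mk))//= [X in _ + X]big1 ?addr0.
    have -> : natdist k (m + k) = m by rewrite /natdist; lia.
    have -> : natdist (m + k) (m + k) = 0%N by rewrite /natdist; lia.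
    by rewrite mulr1.
  move=> l /eqP lk; case: eqP => [z|_]; last by rewrite mulr0.
  by exfalso; apply: lk; apply: val_inj => /=; move: z; rewrite /natdist; lia.
rewrite -big_mkcond /= sumr_const -[LHS]mulr_natl; congr (_%:R * _).
rewrite -sum1_card; transitivity (\sum_(k < M | (k < M - m)%N) 1)%N.
  by apply: eq_bigl => k; rewrite -[LHS]/(m + k < M)%N ltn_subRL.
by rewrite -(big_ord_widen M (fun=> 1%N)) ?leq_subr// sum1_card card_ord.
Qed.

(** Herglotz's theorem with a positive functional in place of a measure. The ultralimit exists
    because the grid functionals of f are bounded by the supremum of |f| on the interval times |c
    0|; on cos (m t) they converge in the ordinary sense, as (M - m) / M tends to 1. *)
Lemma spectral_functional : exists L : (R -> R) -> R, [/\
  forall f g : R -> R, continuous f -> continuous g ->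
    L (fun x => f x + g x) = L f + L g,
  forall (a : R) (f : R -> R), continuous f -> L (fun x => a * f x) = a * L f,
  forall f : R -> R, continuous f ->
    (forall x, `[0, pi *+ 2]%classic x -> 0 <= f x) -> 0 <= L f &
  forall m, L (fun t => cos (m%:R * t)) = c m].
Proof.
have [U [UU ooU]] := ultrafilter_nat; pose G M := grid_functional M.
have grid1 M : (0 < M)%N -> G M (fun=> 1) = c 0%N.
  move=> M0; rewrite -[c 0%N]mul1r -[X in X * _](@divff _ M%:R) ?pnatr_eq0 -?lt0n//.
  rewrite -[X in X%:R / _ * _]subn0 -grid_functional_cos//.
  by congr (G M _); apply/funext => x; rewrite mul0r cos0.
have cvgG f : continuous f -> cvg (G M f @[M --> U]).
  move=> cf; have [B fB] : exists B, forall x, x \in `[0, pi *+ 2] -> `|f x| <= B.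
    have : compact (f @` `[0, pi *+ 2]).
      by apply: continuous_compact; [exact: continuous_subspaceT|exact: segment_compact].
    move=> /compact_bounded[B [_ HB]]; exists (B + 1) => x xI.
    by apply: (HB (B + 1)); [rewrite ltrDl|exists x].
  apply: (@cvg_ultra _ _ _ (B * `|c 0%N|)) => M.
  (* For M = 0 the functional vanishes, the inverse of 0 being 0. The sign of c 0 is read off only
     for M > 0, hence the absolute value in the bound. *)
  have [->|M0] := posnP M.
    rewrite /G /grid_functional invr0 mul0r normr0 mulr_ge0//.
    by rewrite (le_trans (normr_ge0 _) (fB 0 _))// in_itv /= lexx mulrn_wge0 ?pi_ge0.
  have G1 a : G M (fun=> a) = a * c 0%N.
    by rewrite -(grid1 M M0) -grid_functionalZ; congr (G M _); apply/funext => x; rewrite mulr1.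
  have c0 : 0 <= c 0%N.
    rewrite -(grid1 M M0) -[leLHS](mul0r (c 0%N)) -G1.
    exact: le_grid_functional.
  rewrite (ger0_norm c0) ler_norml -mulNr -!G1.
  by apply/andP; split; apply: le_grid_functional => x /fB; rewrite ler_norml => /andP[].
exists (fun f => lim (G M f @[M --> U])); split.
- move=> f g cf cg; under eq_fun do rewrite /G grid_functionalD.
  by apply: cvg_lim => //; apply: cvgD; exact: cvgG.
- move=> a f cf; under eq_fun do rewrite /G grid_functionalZ.
  by apply: cvg_lim => //; apply: cvgMr; exact: cvgG.
- move=> f cf f0; apply: limr_ge; first exact: cvgG.
  apply: nearW => M; rewrite /G -[leLHS](mul0r (G M (fun=> 1))) -grid_functionalZ.
  by apply: le_grid_functional => x xI; rewrite mul0r f0.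
- move=> m; apply: cvg_lim => //.
  have: (M - m)%:R / M%:R * c m @[M --> U] --> c m.
    suff : (M - m)%:R / M%:R * c m @[M --> \oo] --> c m.
      by move=> H A /H /= /ooU.
    rewrite -[X in _ --> X]mul1r; apply: cvgMl.
    have : 1 - m%:R * M%:R^-1 @[M --> \oo] --> 1 - m%:R * (0 : R).
      apply: cvgB; [exact: cvg_cst|apply: cvgMr].
      by rewrite -cvg_shiftS; exact: cvg_harmonic.
    rewrite mulr0 subr0; apply: cvg_trans; apply: near_eq_cvg; exists m.+1 => // M /= mM.
    have M0 : M%:R != 0 :> R by rewrite pnatr_eq0 -lt0n (leq_ltn_trans _ mM).
    by rewrite natrB ?(ltnW mM)// mulrBl divff.
  apply: cvg_trans; apply: near_eq_cvg; apply: ooU; exists m.+1 => // M mM.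
  by rewrite /= /G grid_functional_cos.
Qed.

End spectral_functional.

(** * Koopman operators *)

Section koopman.
Context {d : measure_display} {X : measurableType d} {R : realType}.
Variables (mu : probability X R) (T : X -> X).
Hypothesis mT : measurable_fun setT T.
Hypothesis muT : forall A, measurable A -> mu (T @^-1` A) = mu A.

Lemma iter_measurable k : measurable_fun setT (iter k T).
Proof. by elim: k => [|k IH]; [exact: measurable_id|exact: (measurableT_comp mT IH)]. Qed.

Lemma bmeas_iter (f : X -> R) k : bmeas f -> bmeas (fun x => f (iter k T x)).
Proof. by move=> bf; exact: bmeas_comp (iter_measurable k) bf. Qed.

Lemma mean_iter (f : X -> R) k : bmeas f -> mean mu (fun x => f (iter k T x)) = mean mu f.
Proof.
move=> bf; elim: k => [|k IH]; first exact: eq_mean.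
rewrite -IH.
rewrite -[RHS](mean_comp mT muT (bmeas_iter k bf)).
by apply: eq_mean => x /=; rewrite -iterSr.
Qed.

Lemma bmeas_koopman s (f : X -> R) : bmeas f -> bmeas (koopman_eval T s f).
Proof. by move=> bf; apply: bmeas_sum => p; apply: bmeasZ; exact: bmeas_iter. Qed.

Variable f : X -> R.
Hypothesis bf : bmeas f.

(** The Fourier coefficients of the spectral measure of f; they are even because f is real, so
    natural m suffice. *)
Definition correlation m : R := mean mu (fun x => f x * f (iter m T x)).

Lemma correlationE k l :
  mean mu (fun x => f (iter k T x) * f (iter l T x)) = correlation (natdist k l).
Proof.
wlog kl : k l / (k <= l)%N.
  move=> W; have [/W//|/ltnW/W lk] := leqP k l.
  by rewrite natdistC -lk; apply: eq_mean => x; rewrite mulrC.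
rewrite /correlation -[RHS](@mean_iter _ k); last first.
  by apply: bmeasM => //; exact: bmeas_iter.
apply: eq_mean => x; rewrite -iterD /natdist (eqP kl) add0n subnK//.
Qed.

Lemma mean_koopman_sq s : mean mu (fun x => koopman_eval T s f x ^+ 2) =
  \sum_(p <- s) \sum_(p' <- s) p.1 * p'.1 * correlation (natdist p.2 p'.2).
Proof.
transitivity (mean mu (fun x => \sum_(p <- s) \sum_(p' <- s)
    p.1 * p'.1 * (f (iter p.2 T x) * f (iter p'.2 T x)))).
  apply: eq_mean => x; rewrite expr2 /koopman_eval mulr_suml; apply: eq_bigr => p _.
  by rewrite mulr_sumr; apply: eq_bigr => p' _; rewrite mulrACA.
have bff k l : bmeas (fun x => f (iter k T x) * f (iter l T x)).
  by apply: bmeasM; exact: bmeas_iter.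
rewrite mean_sum => [|p]; last by apply: bmeas_sum => p'; exact: bmeasZ.
apply: eq_bigr => p _; rewrite mean_sum => [|p']; last exact: bmeasZ.
by apply: eq_bigr => p' _; rewrite meanZ// correlationE.
Qed.

(** The quadratic form of [mean_koopman_sq] with cosines in place of correlations. A linear
    functional taking cos (m t) to [correlation m] therefore takes the squared modulus of a
    polynomial to the squared norm of the corresponding Koopman polynomial at f. *)
Lemma sqnorm_circle_eval (s : seq (R * nat)) t : sqnorm (circle_eval s t) =
  \sum_(p <- s) \sum_(p' <- s) p.1 * p'.1 * cos ((natdist p.2 p'.2)%:R * t).
Proof.
have ReE : complex.Re (circle_eval s t) = \sum_(p <- s) p.1 * cos (p.2%:R * t).
  by rewrite Re_sum; apply: eq_bigr => p _ /=; rewrite mul0r subr0.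
have ImE : complex.Im (circle_eval s t) = \sum_(p <- s) p.1 * sin (p.2%:R * t).
  by rewrite Im_sum; apply: eq_bigr => p _ /=; rewrite mul0r addr0.
rewrite /sqnorm ReE ImE !expr2 !mulr_suml -big_split; apply: eq_bigr => p _ /=.
rewrite !mulr_sumr -big_split; apply: eq_bigr => p' _ /=.
by rewrite natdistE; ring.
Qed.

Lemma correlation_pd M (a : nat -> R) :
  0 <= \sum_(k < M) \sum_(l < M) a k * a l * correlation (natdist k l).
Proof.
have := mean_koopman_sq [seq (a k, k) | k <- index_iota 0 M].
rewrite big_map big_mkord; under eq_bigr do rewrite big_map big_mkord /=.
by move=> <-; apply: mean_ge0 => x; exact: sqr_ge0.
Qed.

(* Bounded convergence for L of [spectral_functional], which plays the role of
   the spectral measure of f. *)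
Lemma koopman_cvg0 (P : nat -> seq (R * nat)) C :
  (forall N, abs_coefs (P N) <= C) ->
  (forall t, Normc.normc (circle_eval (P N) t) @[N --> \oo] --> 0) ->
  mean mu (fun x => koopman_eval T (P N) f x ^+ 2) @[N --> \oo] --> 0.
Proof.
move=> PC Pt; have [L [LD LZ L0 Lcos]] := spectral_functional correlation_pd.
have ccos (a : R) k : continuous (fun t : R => a * cos (k%:R * t)).
  move=> t; apply: cvgMr; apply: continuous_comp; first exact: mulrl_continuous.
  exact: continuous_cos.
have csum (I : Type) (r : seq I) (F : I -> R -> R) : (forall i, continuous (F i)) ->
    continuous (fun t => \sum_(i <- r) F i t).
  move=> cF; elim: r => [|i r IH].
    rewrite (_ : (fun t => _) = fun=> 0); first by move=> t; exact: cvg_cst.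
    by apply/funext => t; rewrite big_nil.
  rewrite (_ : (fun t => _) = fun t => F i t + \sum_(j <- r) F j t).
    by move=> t; apply: cvgD; [exact: cF|exact: IH].
  by apply/funext => t; rewrite big_cons.
have Lsum (I : Type) (r : seq I) (F : I -> R -> R) : (forall i, continuous (F i)) ->
    L (fun t => \sum_(i <- r) F i t) = \sum_(i <- r) L (F i).
  move=> cF; elim: r => [|i r IH].
    rewrite big_nil -[RHS](mul0r (L (fun=> 0))) -LZ; last by move=> x; exact: cvg_cst.
    by congr L; apply/funext => t; rewrite big_nil mulr0.
  rewrite big_cons -IH -LD//; last exact: csum.
  by congr L; apply/funext => t; rewrite big_cons.
have cP N : continuous (fun t => sqnorm (circle_eval (P N) t)).
  under eq_fun do rewrite sqnorm_circle_eval.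
  by apply: (@csum _ (P N)) => p; apply: csum => p'; exact: ccos.
have LP N : L (fun t => sqnorm (circle_eval (P N) t)) =
    mean mu (fun x => koopman_eval T (P N) f x ^+ 2).
  rewrite mean_koopman_sq; under eq_fun do rewrite sqnorm_circle_eval.
  rewrite Lsum => [|p]; last by apply: csum => p'; exact: ccos.
  apply: eq_bigr => p _; rewrite Lsum => [|p']; last exact: ccos.
  apply: eq_bigr => p' _; rewrite LZ ?Lcos// => t.
  by apply: continuous_comp; [exact: mulrl_continuous|exact: continuous_cos].
under eq_cvg do rewrite -LP.
apply: (@bounded_convergence R `[0, pi *+ 2] (@segment_compact _ _ _) L LD LZ L0 _ (C ^+ 2)) => //.
- by move=> N x; exact: sqnorm_ge0.
- move=> N x; have xC := le_trans (circle_eval_le (P N) x) (PC N).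
  by rewrite sqnormE ler_pXn2r ?nnegrE ?normc_ge0// (le_trans (normc_ge0 _) xC).
- move=> t _; under eq_cvg do rewrite sqnormE expr2.
  have := cvgM (Pt t) (Pt t); rewrite mulr0; exact.
Qed.

End koopman.

(** * The mean ergodic theorem for bounded functions *)

Section almost_everywhere.
Context {d : measure_display} {X : measurableType d} {R : realType}.
Variable mu : probability X R.

Lemma mean_dominated (u : nat -> X -> R) (v : X -> R) (C : R) :
  (forall N, bmeas (u N)) -> measurable_fun setT v ->
  (forall N x, `|u N x| <= C) ->
  {ae mu, forall x, u N x @[N --> \oo] --> v x} ->
  mean mu (u N) @[N --> \oo] --> mean mu v.
Proof.
move=> bu mv uC uv.
have [|||||iv _ H] := @dominated_convergence _ _ _ mu setT measurableT
  (fun N x => (u N x)%:E) (fun x => (v x)%:E) (fun=> C%:E).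
- by move=> N; apply/measurable_EFinP; case: (bu N).
- exact/measurable_EFinP.
- by apply: filterS uv => x uvx _; apply: cvg_EFin; [exact: nearW|exact: uvx].
- exact: (bmeas_integrable mu (bmeas_cst C)).
- by apply: nearW => x N _; rewrite lee_fin.
apply: fine_cvg.
by rewrite fineK ?(integrable_fin_num _ iv).
Qed.

Lemma level_measurable (h : X -> R) (a : R) : bmeas h ->
  measurable [set x | a <= `|h x|].
Proof.
move=> bh; rewrite (_ : mkset _ = (fun x => `|h x|) @^-1` `[a, +oo[).
  rewrite -[X in measurable X]setTI.
  by apply: (measurableT_comp (@normr_measurable R setT) bh.1).
by apply/seteqP; split=> x /=; rewrite in_itv /= andbT.
Qed.

Lemma chebyshev_mean (h : X -> R) (a : R) : bmeas h -> 0 < a ->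
  (mu [set x | (a <= `|h x|)%R] <= (a ^- 2 * mean mu (fun x => h x ^+ 2))%:E)%E.
Proof.
move=> bh a0; have mS := level_measurable a bh.
have bh2 := bmeasZ (a ^- 2) (bmeasX2 bh).
rewrite -meanZ; last exact: bmeasX2.
rewrite EFin_mean// -[X in mu X]setIT -integral_indic//.
apply: ge0_le_integral => //.
- by apply/measurable_EFinP; exact: measurable_indic.
- by apply/measurable_EFinP; case: bh2.
move=> x _; rewrite lee_fin indicE; case: (boolP (x \in _)) => [|_].
  rewrite inE /= => ax; rewrite mulrC ler_pdivlMr ?exprn_gt0// mul1r.
  by rewrite -[h x ^+ 2]real_normK ?num_real// ler_pXn2r ?nnegrE ?(ltW a0).
by rewrite mulr_ge0 ?sqr_ge0// invr_ge0 sqr_ge0.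
Qed.

Lemma geometric_cauchy_cvg (u : nat -> R) (n : nat) :
  (forall j, (n <= j)%N -> `|u j - u j.+1| <= 2 ^- j) -> cvg (u N @[N --> \oo]).
Proof.
(* The bound is the exact geometric sum of 2^-i over j <= i < j + k, so the induction closes without
   loss. *)
move=> un; have step j k : (n <= j)%N -> `|u j - u (j + k)%N| <= 2 * 2 ^- j - 2 * 2 ^- (j + k).
  move=> nj; elim: k => [|k IH]; first by rewrite addn0 !subrr normr0.
  rewrite addnS -(subrKA (u (j + k)%N)) (le_trans (ler_normD _ _))//.
  have := un (j + k)%N (leq_trans nj (leq_addr _ _)).
  have -> : 2 ^- (j + k).+1 = 2 ^- (j + k) / 2 :> R by rewrite exprS invfM mulrC.
  by move: IH; lra.
apply: cauchy_cvg; apply: cauchy_exP => e e0.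
have [k ke] : exists k, 2 ^- k <= e / 4.
  have e4 : 0 < e / 4 by rewrite divr_gt0.
  exists (Num.truncn (e / 4)^-1); rewrite -[leRHS]invrK lef_pV2 ?posrE ?invr_gt0 ?exprn_gt0//.
  by rewrite (le_trans (ltW (truncnS_gt _)))// -natrX ler_nat ltn_expl.
exists (u (n + k)%N); exists (n + k)%N => // m /= /subnKC <-.
rewrite -ball_normE /=; apply: le_lt_trans (step _ _ (leq_addr _ _)) _.
have : 2 ^- (n + k) <= 2 ^- k :> R.
  by rewrite lef_pV2 ?posrE ?exprn_gt0// ler_weXn2l ?ler1n// leq_addl.
have : 0 < 2 ^- (n + k + (m - (n + k))) :> R by rewrite invr_gt0 exprn_gt0.
lra.
Qed.

(** Chebyshev's inequality at level 2^-j turns 8^-j into 4^j * 8^-j = 2^-j. These measures are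
    summable, so by Borel-Cantelli almost every x eventually has gaps below 2^-j, which are summable
    too. *)
Lemma ae_cvg_rapid (g : nat -> X -> R) : (forall j, bmeas (g j)) ->
  (forall j, mean mu (fun x => (g j x - g j.+1 x) ^+ 2) <= 8 ^- j) ->
  {ae mu, forall x, cvg (g j x @[j --> \oo])}.
Proof.
move=> bg g8; pose F j := [set x | 2 ^- j <= `|g j x - g j.+1 x|].
have bD j : bmeas (fun x => g j x - g j.+1 x) by exact: bmeasB.
have p0 j : 0 < 2 ^- j :> R by rewrite invr_gt0 exprn_gt0.
have muF j : (mu (F j) <= (2 ^- j)%:E)%E.
  rewrite (le_trans (chebyshev_mean (bD j) (p0 j)))// lee_fin.
  have p20 : 0 <= (2 ^- j) ^- 2 :> R by rewrite invr_ge0 sqr_ge0.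
  rewrite (le_trans (ler_wpM2l p20 (g8 j)))//.
  have -> : 8 ^- j = (2 ^- j) ^+ 3 :> R.
    by rewrite -!exprVn -exprM mulnC exprM; congr (_ ^+ j); field.
  by rewrite exprS mulrCA mulVf ?mulr1// expf_neq0// gt_eqF.
have mF j : measurable (F j) by exact: level_measurable (bD j).
have F0 : mu (lim_sup_set F) = 0.
  apply: lim_sup_set_cvg0 => //; apply: (@le_lt_trans _ _ 2%:E); last exact: ltry.
  apply: lime_le; first exact: is_cvg_nneseries.
  apply: nearW => n; apply: (@le_trans _ _ (2 - 2 * 2 ^- n)%:E); last first.
    by rewrite lee_fin lerBlDr lerDl mulr_ge0// ltW.
  elim: n => [|n IH]; first by rewrite big_nil expr0 invr1 mulr1 subrr.
  rewrite big_nat_recr//=; apply: le_trans (leeD IH (muF n)) _.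
  by rewrite -EFinD lee_fin exprS invfM; lra.
exists (lim_sup_set F); split=> //.
  by apply: bigcap_measurable => // k _; exact: bigcup_measurable.
move=> x /= ncvg n _; apply: contrapT => nF; apply: ncvg.
apply: (@geometric_cauchy_cvg _ n) => j nj; rewrite leNgt; apply/negP => Fj.
by apply: nF; exists j => //; exact: ltW.
Qed.

End almost_everywhere.

(** * Limits of asymptotically invariant functions are constant *)

Section ergodic_limit.
Context {d : measure_display} {X : measurableType d} {R : realType}.
Variables (mu : probability X R) (T : X -> X).
Hypothesis ergT : forall A, measurable A -> T @^-1` A = A -> mu A = 0%E \/ mu A = 1%E.
Variables (g : nat -> X -> R) (B : R).
Hypotheses (bg : forall j, bmeas (g j)) (gB : forall j x, `|g j x| <= B).
Hypothesis gT : forall e : R, 0 < e -> exists k, forall j x, (k <= j)%N ->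
  `|g j (T x) - g j x| <= e.

(* The set where limsup g <= r.  Ergodicity is about strictly invariant sets,
   and this one is, unlike the level sets of an almost everywhere limit. *)
Definition limsup_le r : set X := \bigcap_m \bigcup_k \bigcap_(j >= k)
  [set x | g j x <= r + m.+1%:R^-1].

Lemma limsup_leP r x : limsup_le r x <->
  forall m, exists k, forall j, (k <= j)%N -> g j x <= r + m.+1%:R^-1.
Proof.
split=> [Sx m|H m _]; first by have [k _ Hk] := Sx m Logic.I; exists k.
by have [k Hk] := H m; exists k.
Qed.

Lemma limsup_le_measurable r : measurable (limsup_le r).
Proof.
apply: bigcap_measurable => // m _; apply: bigcup_measurable => k _.
apply: bigcap_measurable => [|j _]; first by exists k => /=.
rewrite (_ : mkset _ = g j @^-1` `]-oo, r + m.+1%:R^-1]).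
  by rewrite -[X in measurable X]setTI; apply: (bg j).1.
by apply/seteqP; split=> x /=; rewrite in_itv.
Qed.

Lemma limsup_le_invariant r : T @^-1` limsup_le r = limsup_le r.
Proof.
(* The margin 1 / (m + 1) is split into two margins of index 2 m + 1: one for the bound at x or T x,
   one for moving to the other point. *)
have half m : (2 * m.+1%:R : R)^-1 = (m.*2.+1).+1%:R^-1.
  by congr (_^-1); rewrite -[(m.*2.+1).+1]/(m.+1.*2) -mul2n natrM.
have dbl m : m.+1%:R^-1 = (m.*2.+1).+1%:R^-1 + (m.*2.+1).+1%:R^-1 :> R.
  by rewrite -half invfM; field; rewrite addrC natr1 pnatr_eq0.
have ep m : 0 < (m.*2.+1).+1%:R^-1 :> R by rewrite invr_gt0 ltr0n.
have tr m u v w : u <= r + (m.*2.+1).+1%:R^-1 -> v - u <= (m.*2.+1).+1%:R^-1 ->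
    w = v -> w <= r + m.+1%:R^-1.
  by rewrite (dbl m); set e := (_.+1)%:R^-1 => ue vu ->; lra.
apply/seteqP; split=> x /limsup_leP H; apply/limsup_leP => m;
  have [k Hk] := H m.*2.+1; have [k' Hk'] := gT (ep m);
  exists (maxn k k') => j; rewrite geq_max => /andP[/Hk h1 /(Hk' j x)].
  by rewrite distrC => /(le_trans (ler_norm _)) h2; exact: tr h1 h2 erefl.
by move=> /(le_trans (ler_norm _)) h2; exact: tr h1 h2 erefl.
Qed.

Lemma limsup_le_mono (r s : R) : r <= s -> limsup_le r `<=` limsup_le s.
Proof.
move=> rs x /limsup_leP H; apply/limsup_leP => m; have [k Hk] := H m.
by exists k => j /Hk h; rewrite (le_trans h)// lerD2r.
Qed.

Lemma limsup_le_of_lt (r : R) x (l : R) : g j x @[j --> \oo] --> l -> l < r -> limsup_le r x.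
Proof.
move=> gl lr; apply/limsup_leP => m.
have [k _ Hk] : \forall j \near \oo, g j x <= r.
  move/cvgrPdist_le : gl => /(_ (r - l)); rewrite subr_gt0 => /(_ lr).
  by apply: filterS => j; rewrite distrC => /(le_trans (ler_norm _)); rewrite lerD2r.
by exists k => j /Hk /= h; rewrite (le_trans h)// lerDl invr_ge0.
Qed.

Lemma limsup_le_lim (r : R) x (l : R) : g j x @[j --> \oo] --> l -> limsup_le r x -> l <= r.
Proof.
move=> gl /limsup_leP H; apply/ler_addgt0Pr => e e0.
pose m := Num.truncn e^-1; have [k Hk] := H m.
have me : m.+1%:R^-1 <= e.
  by rewrite -[leRHS]invrK lef_pV2 ?posrE ?invr_gt0// ltW// truncnS_gt.
apply: (@le_trans _ _ (r + m.+1%:R^-1)); last by rewrite lerD2l.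
rewrite -(cvg_lim _ gl)//; apply: limr_le; first by apply/cvg_ex; exists l.
by exists k => // j /= /Hk.
Qed.

(** The set [limsup_le r] grows with r and has measure 0 or 1 by ergodicity; c is the place of the
    jump. The countably many levels c + 1 / (m + 1) and c - 1 / (m + 1) pin the limit to c outside a
    null set. *)
Lemma ergodic_limit_const : {ae mu, forall x, cvg (g j x @[j --> \oo])} ->
  exists c : R, {ae mu, forall x, g j x @[j --> \oo] --> c}.
Proof.
move=> gcvg; pose E := [set r | mu (limsup_le r) = 1%E].
have B0 : 0 <= B by exact: le_trans (gB 0%N point).
have EB : E B.
  rewrite /E /= (_ : limsup_le B = setT) ?probability_setT//.
  apply/seteqP; split=> // x _; apply/limsup_leP => m; exists 0%N => j _.
  by rewrite (le_trans (le_trans (ler_norm _) (gB j x)))// lerDl invr_ge0.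
(* The extra 1 absorbs the margin 1 / (m + 1) at m = 0. *)
have lbE : lbound E (- B - 1).
  move=> r Er; rewrite leNgt; apply/negP => rB.
  suff S0 : limsup_le r = set0.
    by move: Er; rewrite /E /= S0 measure0 => /eqP; rewrite eqe eq_sym oner_eq0.
  apply/seteqP; split=> // x /limsup_leP/(_ 0%N)[k /(_ k (leqnn k))].
  by rewrite invr1; have := gB k x; rewrite ler_norml => /andP[]; lra.
have hE : has_inf E by split; [exists B|exists (- B - 1)].
pose c := inf E; exists c.
have up (r : R) : c < r -> mu (limsup_le r) = 1%E.
  move=> cr; have [s Es sr] := inf_lt hE.1 cr.
  have mS := @limsup_le_mono s r (ltW sr); apply/eqP; rewrite eq_le probability_le1//=.
    by rewrite -Es; apply: le_measure => //; rewrite inE; exact: limsup_le_measurable.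
  exact: limsup_le_measurable.
have dn (r : R) : r < c -> mu (limsup_le r) = 0%E.
  move=> rc; have [//|Sr] := ergT (limsup_le_measurable r) (limsup_le_invariant r).
  by move: rc; rewrite ltNge => /negP[]; apply: ge_inf => //; case: hE.
have aeup m : {ae mu, forall x, limsup_le (c + m.+1%:R^-1) x}.
  exists (~` limsup_le (c + m.+1%:R^-1)); split=> //.
    by apply: measurableC; exact: limsup_le_measurable.
  rewrite probability_setC; last exact: limsup_le_measurable.
  by rewrite up ?subee// ltrDl invr_gt0.
have aedn m : {ae mu, forall x, ~ limsup_le (c - m.+1%:R^-1) x}.
  exists (limsup_le (c - m.+1%:R^-1)); split=> //.
  - exact: limsup_le_measurable.
  - by rewrite dn// ltrBlDr ltrDl invr_gt0.
  - by move=> x /= /contrapT.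
have := ae_foralln aedn; have := ae_foralln aeup; move: gcvg.
apply: filterS3 => x /cvg_ex[l gl] xup xdn.
suff -> : c = l by [].
apply/eqP; rewrite eq_le; apply/andP; split.
  rewrite leNgt; apply/negP => lc; pose m := Num.truncn (c - l)^-1.
  apply: (xdn m); apply: (limsup_le_of_lt gl); rewrite ltrBrDr -ltrBrDl.
  by rewrite -[ltRHS]invrK ltf_pV2 ?posrE ?invr_gt0 ?subr_gt0// truncnS_gt.
apply/ler_addgt0Pr => e e0; pose m := Num.truncn e^-1.
apply: (le_trans (limsup_le_lim gl (xup m))); rewrite lerD2l.
by rewrite -[leRHS]invrK lef_pV2 ?posrE ?invr_gt0// ltW// truncnS_gt.
Qed.

End ergodic_limit.

(** * Cesaro and IP averages of bounded functions *)

Section mean_ergodic.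
Context {d : measure_display} {X : measurableType d} {R : realType}.
Variables (mu : probability X R) (T : X -> X).
Hypothesis mT : measurable_fun setT T.
Hypothesis muT : forall A, measurable A -> mu (T @^-1` A) = mu A.
Hypothesis ergT : forall A, measurable A -> T @^-1` A = A -> mu A = 0%E \/ mu A = 1%E.
Variable f : X -> R.
Hypothesis bf : bmeas f.

Definition cesaro N : X -> R := koopman_eval T (cesaro_coefs R N) f.

Lemma bmeas_cesaro N : bmeas (cesaro N).
Proof. exact: bmeas_koopman. Qed.

Lemma cesaroE N x : cesaro N x = N%:R^-1 * \sum_(0 <= k < N) f (iter k T x).
Proof.
rewrite /cesaro /koopman_eval big_map /index_iota subn0 mulr_sumr.
by [].
Qed.

Lemma mean_cesaro N : (0 < N)%N -> mean mu (cesaro N) = mean mu f.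
Proof.
move=> N0; transitivity (mean mu (fun x => N%:R^-1 * \sum_(0 <= k < N) f (iter k T x))).
  by apply: eq_mean => x; rewrite cesaroE.
have bk k : bmeas (fun x => f (iter k T x)) by exact: bmeas_iter.
rewrite meanZ; last exact: bmeas_sum.
rewrite mean_sum//; under eq_bigr do rewrite mean_iter//.
by rewrite sumr_const_nat subn0 -[X in _ * X]mulr_natl mulKf// pnatr_eq0 -lt0n.
Qed.

Lemma cesaro_le B N x : (forall x, `|f x| <= B) -> `|cesaro N x| <= B.
Proof.
move=> fB; have B0 : 0 <= B := le_trans (normr_ge0 _) (fB x).
rewrite cesaroE normrM ger0_norm ?invr_ge0//.
have [->|N0] := posnP N; first by rewrite invr0 mul0r.
rewrite ler_pdivrMl ?ltr0n// (le_trans (ler_norm_sum _ _ _))//.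
rewrite (le_trans (ler_sum _ (fun k _ => fB (iter k T x))))//.
by rewrite sumr_const_nat subn0 mulr_natl.
Qed.

Lemma cesaro_shift B N x : (forall x, `|f x| <= B) ->
  `|cesaro N (T x) - cesaro N x| <= N%:R^-1 * (2 * B).
Proof.
move=> fB; rewrite !cesaroE -mulrBr normrM ger0_norm ?invr_ge0//.
rewrite ler_wpM2l ?invr_ge0// -sumrB.
under eq_bigr do rewrite -iterSr.
rewrite (telescope_sumr (fun k => f (iter k T x)))//.
rewrite (le_trans (ler_normB _ _))//= mulr2n mulrDl mul1r lerD//.
Qed.

(** [koopman_cvg0] takes a sequence of polynomials, so a failure of the Cauchy property is turned
    into one: the differences of Cesaro polynomials along bad pairs. They tend to 0 at every point
    of the circle, including 1. *)
Lemma cesaro_cauchy e : 0 < e -> exists K, forall N M, (K <= N)%N -> (K <= M)%N ->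
  mean mu (fun x => (cesaro N x - cesaro M x) ^+ 2) <= e.
Proof.
move=> e0; apply: contrapT => /forallNP H.
have bad K : exists p : nat * nat, [/\ (K <= p.1)%N, (K <= p.2)%N &
    e < mean mu (fun x => (cesaro p.1 x - cesaro p.2 x) ^+ 2)].
  apply: contrapT => nb; apply: (H K) => N M KN KM; rewrite leNgt; apply/negP => h.
  by apply: nb; exists (N, M).
have [p Hp] := choice bad.
pose P K := sub_coefs (cesaro_coefs R (p K).1) (cesaro_coefs R (p K).2).
have p1oo : (p K).1 @[K --> \oo] --> \oo.
  by move=> A [k _ kA]; exists k => // K /= kK; apply: kA; case: (Hp K) => /(leq_trans kK).
have p2oo : (p K).2 @[K --> \oo] --> \oo.
  by move=> A [k _ kA]; exists k => // K /= kK; apply: kA; case: (Hp K) => _ /(leq_trans kK).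
have abs2 K : abs_coefs (P K) <= 2.
  by rewrite abs_coefs_sub -[2]/(1 + 1) lerD// abs_coefs_cesaro.
have pt t : Normc.normc (circle_eval (P K) t) @[K --> \oo] --> 0.
  under eq_cvg do rewrite circle_eval_sub.
  have [t1|t1] := eqVneq (cos t) 1.
    apply: cvg_near_cst; exists 1%N => // K /= K0; have [k1 k2 _] := Hp K.
    by rewrite !cesaro_eval_one ?(leq_trans K0)// subrr Normc.normc0.
  have c1 := cvg_comp _ _ p1oo (cesaro_eval_cvg0 t1).
  have c2 := cvg_comp _ _ p2oo (cesaro_eval_cvg0 t1).
  have cs : Normc.normc (circle_eval (cesaro_coefs R (p K).1) t) +
      Normc.normc (circle_eval (cesaro_coefs R (p K).2) t) @[K --> \oo] --> 0.
    by have := cvgD c1 c2; rewrite addr0; exact.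
  apply: squeeze_cvgr (cvg_cst 0) cs.
  apply: nearW => K; rewrite normc_ge0 /= (le_trans (le_normcD _ _))//.
  by rewrite normcN.
have /cvgrPdist_le/(_ (e / 2)) := koopman_cvg0 mT muT bf abs2 pt.
rewrite divr_gt0// => /(_ isT)[K _ /(_ K (leqnn K))] /=.
rewrite sub0r normrN => /(le_trans (ler_norm _)).
have [_ _ +] := Hp K.
rewrite (_ : mean mu (fun x => koopman_eval T (P K) f x ^+ 2) =
    mean mu (fun x => (cesaro (p K).1 x - cesaro (p K).2 x) ^+ 2)).
  by move=> h1 h2; have := lt_le_trans h1 h2; lra.
by apply: eq_mean => x; rewrite koopman_eval_sub.
Qed.

Lemma rapid_subsequence : exists Ns : nat -> nat,
  (forall j, (j < Ns j)%N) /\ forall j N, (Ns j <= N)%N ->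
    mean mu (fun x => (cesaro (Ns j) x - cesaro N x) ^+ 2) <= 8 ^- j /\
    mean mu (fun x => (cesaro (Ns j) x - cesaro (Ns j.+1) x) ^+ 2) <= 8 ^- j.
Proof.
have p8 j : 0 < 8 ^- j :> R by rewrite invr_gt0 exprn_gt0.
have [K HK] := choice (fun j => cesaro_cauchy (p8 j)).
(* The partial sums make [Ns] nondecreasing and at least K; the summand j + 1 forces it above j. *)
pose Ns j := (j.+1 + \sum_(i < j.+1) K i)%N.
have KNs j : (K j <= Ns j)%N by rewrite /Ns big_ord_recr /= addnA leq_addl.
exists Ns; split=> [j|j N jN]; first by rewrite /Ns addSn ltnS leq_addr.
split; apply: HK => //; first exact: leq_trans jN.
by apply: leq_trans (KNs j) _; rewrite /Ns [in leqRHS]big_ord_recr /=; lia.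
Qed.

Lemma mean_sq_le (u v : X -> R) : bmeas u -> bmeas v ->
  mean mu (fun x => (u x + v x) ^+ 2) <=
  2 * mean mu (fun x => u x ^+ 2) + 2 * mean mu (fun x => v x ^+ 2).
Proof.
move=> bu bv; rewrite -!meanZ; [|exact: bmeasX2|exact: bmeasX2].
rewrite -meanD; [|exact/bmeasZ/bmeasX2|exact/bmeasZ/bmeasX2].
apply: le_mean => [||x].
- by apply: bmeasX2; exact: bmeasD.
- by apply: bmeasD; apply: bmeasZ; exact: bmeasX2.
- by have := sqr_ge0 (u x - v x); nra.
Qed.

(** A rapidly Cauchy subsequence of Cesaro means converges almost everywhere. T moves each mean by
    at most 2 B / N, so the limit is a constant, equal to the mean of f by dominated convergence.
    The Cauchy property then extends L2 convergence to the full sequence. *)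
Lemma mean_ergodic : mean mu (fun x => (cesaro N x - mean mu f) ^+ 2) @[N --> \oo] --> 0.
Proof.
have [Ns [jNs HNs]] := rapid_subsequence.
have [_ [B fB]] := bf; have B0 : 0 <= B := le_trans (normr_ge0 _) (fB point).
pose g j := cesaro (Ns j).
have bg j : bmeas (g j) by exact: bmeas_cesaro.
have gB j x : `|g j x| <= B by exact: cesaro_le.
have gT e : 0 < e -> exists k, forall j x, (k <= j)%N -> `|g j (T x) - g j x| <= e.
  move=> e0; exists (Num.truncn (2 * B / e)) => j x kj.
  rewrite (le_trans (cesaro_shift (Ns j) x fB))// ler_pdivrMl; last first.
    by rewrite ltr0n (leq_ltn_trans _ (jNs j)).
  rewrite -ler_pdivrMr// (le_trans (ltW (truncnS_gt _)))// ler_nat.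
  exact: leq_ltn_trans (jNs j).
have g8 j : mean mu (fun x => (g j x - g j.+1 x) ^+ 2) <= 8 ^- j.
  by have [_ ] := HNs j (Ns j) (leqnn _).
have [c gc] := ergodic_limit_const ergT bg gB gT (ae_cvg_rapid bg g8).
have cE : c = mean mu f.
  have := mean_dominated bg (measurable_cst c) gB gc; rewrite mean_cst => gc'.
  rewrite -(cvg_lim _ gc')//; apply: lim_near_cst => //; apply: nearW => j.
  by rewrite mean_cesaro// (leq_ltn_trans _ (jNs j)).
have bgc j : bmeas (fun x => g j x - c) by apply: bmeasB => //; exact: bmeas_cst.
have gc2 : mean mu (fun x => (g j x - c) ^+ 2) @[j --> \oo] --> 0.
  rewrite -[X in _ --> X](mean_cst mu 0).
  apply: (@mean_dominated _ _ _ _ _ _ ((B + `|c|) ^+ 2)).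
  - by move=> j; exact: bmeasX2.
  - exact: measurable_cst.
  - move=> j x; rewrite ger0_norm ?sqr_ge0// -[leLHS]real_normK ?num_real//.
    rewrite ler_pXn2r ?nnegrE ?addr_ge0//.
    by rewrite (le_trans (ler_normB _ _))// lerD2r.
  - apply: filterS gc => x gx.
    have gx0 : g j x - c @[j --> \oo] --> 0.
      by rewrite -(subrr c); apply: cvgB => //; exact: cvg_cst.
    by under eq_cvg do rewrite expr2; have := cvgM gx0 gx0; rewrite mulr0; exact.
rewrite -cE; apply/cvgrPdist_le => e e0.
(* Two errors, each doubled by [mean_sq_le]. *)
have e4 : 0 < e / 4 by rewrite divr_gt0.
have p8 : 8 ^- j @[j --> \oo] --> (0 : R).
  under eq_cvg do rewrite -exprVn.
  by apply: cvg_expr; rewrite ger0_norm ?invr_ge0// invf_lt1// ltr1n.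
have /cvgrPdist_le/(_ _ e4)[k1 _ Hk1] := gc2.
have /cvgrPdist_le/(_ _ e4)[k2 _ Hk2] := p8.
pose j := maxn k1 k2; exists (Ns j) => // N /= jN.
have m0 : 0 <= mean mu (fun x => (cesaro N x - c) ^+ 2).
  by apply: mean_ge0 => x; exact: sqr_ge0.
rewrite sub0r normrN ger0_norm//.
have [h1 _] := HNs j N jN.
have := Hk1 j (leq_maxl _ _); have := Hk2 j (leq_maxr _ _) => /=.
rewrite !sub0r !normrN => /(le_trans (ler_norm _)) h2 /(le_trans (ler_norm _)) h3.
have -> : mean mu (fun x => (cesaro N x - c) ^+ 2) =
    mean mu (fun x => ((cesaro N x - g j x) + (g j x - c)) ^+ 2).
  by apply: eq_mean => x; rewrite subrKA.
rewrite (le_trans (mean_sq_le _ _))//.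
  by apply: bmeasB => //; exact: bmeas_cesaro.
have -> : mean mu (fun x => (cesaro N x - g j x) ^+ 2) =
    mean mu (fun x => (cesaro (Ns j) x - cesaro N x) ^+ 2).
  by apply: eq_mean => x; rewrite -sqrrN opprB.
lra.
Qed.

Lemma mean_ip (n : nat -> nat) (Phi : nat -> {fset nat}) :
  Folner R Phi -> equidistributed R n Phi ->
  mean mu (fun x => (IPavg (Phi N) n (fun k => f (iter k T x)) - mean mu f) ^+ 2)
    @[N --> \oo] --> 0.
Proof.
move=> PhiF equi; pose P N := sub_coefs (ip_coefs R (Phi N) n) (cesaro_coefs R N).
have abs2 N : abs_coefs (P N) <= 2.
  by rewrite abs_coefs_sub abs_coefs_ip -[2]/(1 + 1) lerD2l abs_coefs_cesaro.
have pt t : Normc.normc (circle_eval (P N) t) @[N --> \oo] --> 0.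
  under eq_cvg do rewrite circle_eval_sub.
  have [t1|t1] := eqVneq (cos t) 1.
    apply: cvg_near_cst; exists 1%N => // N /= N0.
    by rewrite ip_eval_one// cesaro_eval_one// subrr Normc.normc0.
  have cs : Normc.normc (circle_eval (ip_coefs R (Phi N) n) t) +
      Normc.normc (circle_eval (cesaro_coefs R N) t) @[N --> \oo] --> 0.
    by have := cvgD (ip_eval_cvg0 PhiF equi t1) (cesaro_eval_cvg0 t1); rewrite addr0; exact.
  apply: squeeze_cvgr (cvg_cst 0) cs.
  apply: nearW => N; rewrite normc_ge0 /= (le_trans (le_normcD _ _))//.
  by rewrite normcN.
have k0 := koopman_cvg0 mT muT bf abs2 pt; have e0 := mean_ergodic.
have : 2 * mean mu (fun x => koopman_eval T (P N) f x ^+ 2) +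
    2 * mean mu (fun x => (cesaro N x - mean mu f) ^+ 2) @[N --> \oo] --> 0.
  have := cvgD (cvgMl_tmp (a := 2) k0) (cvgMl_tmp (a := 2) e0).
  by rewrite !mulr0 addr0; exact.
apply: squeeze_cvgr (cvg_cst 0); apply: nearW => N.
rewrite mean_ge0 => [|x]; last exact: sqr_ge0.
have bc : bmeas (fun x => cesaro N x - mean mu f).
  by apply: bmeasB; [exact: bmeas_cesaro|exact: bmeas_cst].
have bk : bmeas (koopman_eval T (P N) f) by exact: bmeas_koopman.
apply: le_trans (mean_sq_le bk bc); rewrite le_eqVlt; apply/orP; left; apply/eqP.
apply: eq_mean => x; congr (_ ^+ 2).
by rewrite koopman_eval_sub koopman_eval_ip /cesaro subrKA.
Qed.

End mean_ergodic.

(** * Truncation of square integrable functions *)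

Section square_integral.
Context {d : measure_display} {X : measurableType d} {R : realType}.
Variables (mu : probability X R) (T : X -> X).
Hypothesis mT : measurable_fun setT T.
Hypothesis muT : forall A, measurable A -> mu (T @^-1` A) = mu A.
Implicit Types h : X -> R.

Definition sqint h : \bar R := (\int[mu]_x (h x ^+ 2)%:E)%E.

Lemma sqint_ge0 h : (0 <= sqint h)%E.
Proof. by apply: integral_ge0 => x _; rewrite lee_fin sqr_ge0. Qed.

Lemma measurable_EFin_sqr h : measurable_fun setT h ->
  measurable_fun setT (fun x => (h x ^+ 2)%:E).
Proof. by move=> mh; apply/measurable_EFinP; exact: measurable_funX. Qed.

Lemma sqint_bmeas h : bmeas h -> sqint h = (mean mu (fun x => h x ^+ 2))%:E.
Proof. by move=> bh; rewrite EFin_mean//; exact: bmeasX2. Qed.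

Lemma sqintD3 h1 h2 h3 : measurable_fun setT h1 -> measurable_fun setT h2 ->
  measurable_fun setT h3 ->
  (sqint (fun x => h1 x + h2 x + h3 x)%R <=
   3%:E * (sqint h1 + sqint h2 + sqint h3))%E.
Proof.
move=> m1 m2 m3; have s1 := measurable_EFin_sqr m1; have s2 := measurable_EFin_sqr m2.
have s3 := measurable_EFin_sqr m3.
have sq0 h x : (0 <= (h x ^+ 2)%:E)%E by rewrite lee_fin sqr_ge0.
rewrite -!ge0_integralD//; last 2 first.
- by move=> x _; rewrite adde_ge0.
- exact: emeasurable_funD.
rewrite -ge0_integralZl//; last 2 first.
- by apply: emeasurable_funD => //; exact: emeasurable_funD.
- by move=> x _; rewrite !adde_ge0.
apply: ge0_le_integral => //.
- by move=> x _; rewrite lee_fin sqr_ge0.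
- by apply: measurable_EFin_sqr; apply: measurable_funD => //; exact: measurable_funD.
- by apply: measurable_funeM; apply: emeasurable_funD => //; exact: emeasurable_funD.
move=> x _; rewrite -!EFinD -EFinM lee_fin.
have := sqr_ge0 (h1 x - h2 x); have := sqr_ge0 (h1 x - h3 x).
have := sqr_ge0 (h2 x - h3 x); nra.
Qed.

Lemma sqint_iter h k : measurable_fun setT h ->
  (\int[mu]_x (h (iter k T x) ^+ 2)%:E)%E = sqint h.
Proof.
move=> mh; elim: k => [|k IH] //; rewrite -IH.
have mk : measurable_fun setT (fun x => (h (iter k T x) ^+ 2)%:E).
  apply: measurable_EFin_sqr; exact: measurableT_comp mh (iter_measurable mT k).
transitivity (\int[pushforward mu T]_x (h (iter k T x) ^+ 2)%:E)%E.
  rewrite ge0_integral_pushforward// => [|x _]; last by rewrite lee_fin sqr_ge0.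
  by rewrite preimage_setT; apply: eq_integral => x _ /=; rewrite -iterSr.
by apply: eq_measure_integral => A mA _; exact: muT.
Qed.

(** Jensen's inequality for the square, from the nonnegativity of the variance. *)
Lemma sqr_average_le (s : seq {fset nat}) (a : {fset nat} -> R) : (0 < size s)%N ->
  ((size s)%:R^-1 * \sum_(i <- s) a i) ^+ 2 <= (size s)%:R^-1 * \sum_(i <- s) a i ^+ 2.
Proof.
move=> s0; set w := (size s)%:R^-1; set m := w * _.
have w0 : 0 <= w by rewrite invr_ge0.
have : 0 <= w * \sum_(i <- s) (a i - m) ^+ 2.
  by rewrite mulr_ge0// sumr_ge0// => i _; exact: sqr_ge0.
have -> : \sum_(i <- s) (a i - m) ^+ 2 =
    \sum_(i <- s) a i ^+ 2 - 2 * m * \sum_(i <- s) a i + (size s)%:R * m ^+ 2.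
  rewrite -sum1_size natr_sum mulr_suml mulr_sumr -sumrB -big_split.
  by apply: eq_bigr => i _ /=; ring.
rewrite mulrDr mulrBr mulrCA -/m [w * (_ * _)]mulrA mulVf ?pnatr_eq0 -?lt0n//.
by rewrite mul1r; nra.
Qed.

(** Jensen's inequality under the integral, then invariance of mu in each term. The truncation error
    is thereby controlled uniformly in N. *)
Lemma sqint_ip A n h : measurable_fun setT h ->
  (sqint (fun x => IPavg A n (fun k => h (iter k T x))) <= sqint h)%E.
Proof.
move=> mh; have szE : size (fpowerset A) = (2 ^ #|` A|)%N by rewrite -card_fpowerset.
have mk k : measurable_fun setT (fun x => h (iter k T x)).
  exact: measurableT_comp mh (iter_measurable mT k).
pose w : R := (2 ^+ #|` A|)^-1.
have wE : w = (size (fpowerset A))%:R^-1 by rewrite szE natrX.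
have w0 : 0 <= w by rewrite invr_ge0 exprn_ge0.
have msum : measurable_fun setT
    (fun x => \sum_(F <- fpowerset A) h (iter (\sum_(j <- F) n j)%N T x)).
  by apply: measurable_sum => F; exact: mk.
apply: (@le_trans _ _ (\int[mu]_x (w%:E *
    \sum_(F <- fpowerset A) (h (iter (\sum_(j <- F) n j)%N T x) ^+ 2)%:E))%E).
  apply: ge0_le_integral => //.
  - by move=> x _; rewrite lee_fin sqr_ge0.
  - by apply: measurable_EFin_sqr; apply: measurable_funM.
  - apply: measurable_funeM; apply: emeasurable_sum => F; exact: measurable_EFin_sqr.
  move=> x _; rewrite sumEFin -EFinM lee_fin /IPavg -/w wE.
  by apply: sqr_average_le; rewrite szE expn_gt0.
rewrite ge0_integralZl//; last 2 first.
- by apply: emeasurable_sum => F; exact: measurable_EFin_sqr.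
- by move=> x _; apply: sume_ge0 => F _; rewrite lee_fin sqr_ge0.
rewrite ge0_integral_sum//; last first.
- by move=> F x _; rewrite lee_fin sqr_ge0.
- by move=> F; exact: measurable_EFin_sqr.
under eq_bigr do rewrite sqint_iter//.
have := sqint_ge0 h; case: (sqint h) => [r _|_|//]; last exact: leey.
rewrite sumEFin -EFinM lee_fin big_const_seq count_predT iter_addr_0 -[r *+ _]mulr_natl.
by rewrite wE mulKf// pnatr_eq0 szE expn_eq0.
Qed.

End square_integral.

Section truncation.
Context {d : measure_display} {X : measurableType d} {R : realType}.
Variables (mu : probability X R) (T : X -> X).
Hypothesis mT : measurable_fun setT T.
Hypothesis muT : forall A, measurable A -> mu (T @^-1` A) = mu A.
Hypothesis ergT : forall A, measurable A -> T @^-1` A = A -> mu A = 0%E \/ mu A = 1%E.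
Variables (n : nat -> nat) (Phi : nat -> {fset nat}).
Hypotheses (PhiF : Folner R Phi) (equi : equidistributed R n Phi).
Variable u : X -> R.
Hypotheses (mu_ : measurable_fun setT u) (u2 : (sqint mu u < +oo)%E).

Definition clamp (K : nat) (x : R) : R := Num.max (- K%:R) (Num.min K%:R x).

Lemma clamp_le K x : `|clamp K x| <= K%:R.
Proof.
rewrite /clamp ler_norml le_max lexx /= ge_max ge_min lexx /= andbT.
by rewrite (le_trans _ (ler0n _ K))// oppr_le0.
Qed.

Lemma clamp_dist K x : `|x - clamp K x| <= `|x|.
Proof.
rewrite /clamp; have K0 : 0 <= K%:R :> R by [].
case: (leP K%:R x) => Kx.
  rewrite max_r; last by lra.
  rewrite !ger0_norm; lra.
case: (leP (- K%:R) x) => xK; first by rewrite subrr normr0.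
by rewrite !ler0_norm; lra.
Qed.

Lemma clamp_id K x : `|x| <= K%:R -> clamp K x = x.
Proof. by rewrite ler_norml => /andP[x1 x2]; rewrite /clamp min_r// max_r. Qed.

Lemma bmeas_clamp K : bmeas (fun x => clamp K (u x)).
Proof.
split; last by exists K%:R => x; exact: clamp_le.
by apply: measurable_maxr => //; apply: measurable_minr.
Qed.

Lemma clamp_cvg x : clamp K x @[K --> \oo] --> x.
Proof.
apply: cvg_near_cst; exists (Num.truncn `|x|).+1 => // K /= xK.
apply: clamp_id; rewrite (le_trans (ltW (truncnS_gt _)))// ler_nat//.
Qed.

Lemma sqint_clamp_cvg0 : sqint mu (fun x => u x - clamp K (u x)) @[K --> \oo] --> 0%E.
Proof.
have iu2 : mu.-integrable setT (fun x => (u x ^+ 2)%:E).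
  apply/integrableP; split; first exact: measurable_EFin_sqr.
  by under eq_integral do rewrite gee0_abs ?lee_fin ?sqr_ge0//.
have [|||||_ _ H] := @dominated_convergence _ _ _ mu setT measurableT
  (fun K x => ((u x - clamp K (u x)) ^+ 2)%:E) (fun=> 0%E) (fun x => (u x ^+ 2)%:E).
- move=> K; apply: measurable_EFin_sqr; apply: measurable_funB => //.
  exact: (bmeas_clamp K).1.
- exact: measurable_cst.
- apply: nearW => x _; apply: cvg_EFin; first exact: nearW.
  have c0 : u x - clamp K (u x) @[K --> \oo] --> 0.
    by rewrite -(subrr (u x)); apply: cvgB; [exact: cvg_cst|exact: clamp_cvg].
  under eq_cvg do rewrite /= expr2; have := cvgM c0 c0; rewrite mulr0; exact.
- exact: iu2.
- apply: nearW => x K _; rewrite gee0_abs ?lee_fin ?sqr_ge0//.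
  by rewrite -[leLHS]real_normK ?num_real// -[leRHS]real_normK ?num_real//
    ler_pXn2r ?nnegrE// clamp_dist.
by rewrite integral0 in H; exact: H.
Qed.

Lemma mean_clamp_cvg : mean mu (fun x => clamp K (u x)) @[K --> \oo] --> mean mu u.
Proof.
have iu : mu.-integrable setT (EFin \o (fun x => `|u x|)).
  apply/integrableP; split; first by apply/measurable_EFinP; exact: measurableT_comp.
  (* On a probability space square integrability gives integrability, through |u| <= 1 + u^2. *)
  apply: (@le_lt_trans _ _ (\int[mu]_x (1%:E + (u x ^+ 2)%:E))%E).
    apply: ge0_le_integral => //.
    - by apply: measurableT_comp => //; apply/measurable_EFinP; exact: measurableT_comp.
    - by apply: emeasurable_funD => //; exact: measurable_EFin_sqr.
    move=> x _; rewrite /= normr_id -EFinD lee_fin -[u x ^+ 2]real_normK ?num_real//.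
    by have := sqr_ge0 (`|u x| - 1); have := sqr_ge0 `|u x|; lra.
  rewrite ge0_integralD//; last 2 first.
  - by move=> x _; rewrite lee_fin sqr_ge0.
  - exact: measurable_EFin_sqr.
  rewrite integral_cst// [X in (_ * X)%E]probability_setT mul1e.
  by rewrite lte_add_pinfty// ltry.
have [|||||iv _ H] := @dominated_convergence _ _ _ mu setT measurableT
  (fun K x => (clamp K (u x))%:E) (fun x => (u x)%:E) (fun x => `|u x|%:E).
- by move=> K; apply/measurable_EFinP; exact: (bmeas_clamp K).1.
- exact/measurable_EFinP.
- by apply: nearW => x _; apply: cvg_EFin; [exact: nearW|exact: clamp_cvg].
- exact: iu.
- apply: nearW => x K _; rewrite lee_fin /clamp; case: (leP K%:R (u x)) => Kx.
    by rewrite max_r ?ger0_norm// ?(le_trans _ Kx)//; have : 0 <= K%:R :> R by []; lra.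
  case: (leP (- K%:R) (u x)) => // xK.
  have K0 : 0 <= K%:R :> R by [].
  by rewrite normrN ger0_norm// ler0_norm; lra.
by apply: fine_cvg; rewrite fineK ?(integrable_fin_num _ iv).
Qed.

(** The error splits into the IP average of u minus its truncation, the bounded case for the
    truncation, and the difference of the two means. The first and third are small for a suitable K
    whatever N is, so K is fixed before N. *)
Lemma sqint_ip_cvg0 : sqint mu (fun x =>
  IPavg (Phi N) n (fun k => u (iter k T x)) - mean mu u) @[N --> \oo] --> 0%E.
Proof.
pose v N x := IPavg (Phi N) n (fun k => u (iter k T x)) - mean mu u.
rewrite -[X in X @ _]/(fun N => sqint mu (v N)).
suff key (e : R) : 0 < e -> \forall N \near \oo, (sqint mu (v N) <= e%:E)%E.
  apply/fine_cvgP; split.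
    apply: filterS (key 1 ltr01) => N h.
    by rewrite ge0_fin_numE ?sqint_ge0// (le_lt_trans h) ?ltry.
  apply/cvgrPdist_le => e e0; apply: filterS (key e e0) => N /=.
  rewrite sub0r normrN => h; rewrite ger0_norm ?fine_ge0 ?sqint_ge0//.
  rewrite -lee_fin fineK// ge0_fin_numE ?sqint_ge0// (le_lt_trans h) ?ltry//.
(* Three errors, each multiplied by 3 in [sqintD3]. *)
move=> e0; have e9 : 0 < e / 9 by rewrite divr_gt0.
have [K KE Km] : exists2 K, (sqint mu (fun x => u x - clamp K (u x))%R <= (e / 9)%:E)%E &
    (mean mu (fun x => clamp K (u x)) - mean mu u) ^+ 2 <= e / 9.
  have /fine_cvgP[fin /cvgrPdist_le/(_ _ e9) H1] := sqint_clamp_cvg0.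
  have m0 : mean mu (fun x => clamp K (u x)) - mean mu u @[K --> \oo] --> 0.
    by rewrite -(subrr (mean mu u)); apply: cvgB; [exact: mean_clamp_cvg|exact: cvg_cst].
  have m2 : (mean mu (fun x => clamp K (u x)) - mean mu u) ^+ 2 @[K --> \oo] --> 0.
    by under eq_cvg do rewrite expr2; have := cvgM m0 m0; rewrite mulr0; exact.
  move/cvgrPdist_le/(_ _ e9) : m2 => H2.
  have [k _ /(_ k (leqnn k))] := filterI fin (filterI H1 H2).
  move=> /= [f1 []]; rewrite !sub0r !normrN => h1 h2; exists k.
    by rewrite -(fineK f1) lee_fin (le_trans (ler_norm _)).
  exact: le_trans (ler_norm _) h2.
have bc := bmeas_clamp K; pose m := mean mu (fun x => clamp K (u x)).
have /cvgrPdist_le/(_ _ e9) := mean_ip mT muT ergT bc PhiF equi.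
apply: filterS => N; rewrite sub0r normrN => /(le_trans (ler_norm _)) hN.
have mc : measurable_fun setT (fun x => u x - clamp K (u x)).
  by apply: measurable_funB => //; exact: bc.1.
have bip : bmeas (fun x => IPavg (Phi N) n (fun k => clamp K (u (iter k T x)))).
  rewrite (_ : (fun x => _) =
      koopman_eval T (ip_coefs R (Phi N) n) (fun x => clamp K (u x))).
    exact: bmeas_koopman.
  by apply/funext => x; rewrite koopman_eval_ip.
have -> : sqint mu (v N) = sqint mu (fun x =>
    IPavg (Phi N) n (fun k => u (iter k T x) - clamp K (u (iter k T x))) +
    (IPavg (Phi N) n (fun k => clamp K (u (iter k T x))) - m) + (m - mean mu u)).
  apply: eq_integral => x _; rewrite /v; congr ((_ ^+ 2)%:E).
  by rewrite /IPavg sumrB mulrBr; ring.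
apply: le_trans (sqintD3 _ _ _ _) _.
- apply: measurable_funM => //; apply: measurable_sum => F.
  exact: measurableT_comp mc (iter_measurable mT _).
- by apply: measurable_funB => //; exact: bip.1.
- exact: measurable_cst.
have s1 := le_trans (sqint_ip mT muT (Phi N) n mc) KE.
have s2 := sqint_bmeas mu (bmeasB bip (bmeas_cst m)).
have s3 := sqint_bmeas mu (bmeas_cst (X := X) (m - mean mu u)).
rewrite s2 s3 mean_cst.
apply: (@le_trans _ _ (3%:E * ((e / 9)%:E + (e / 9)%:E + (e / 9)%:E))%E).
  by rewrite lee_pmul2l//; apply: leeD; [apply: leeD|]; rewrite ?lee_fin.
by rewrite -!EFinD -EFinM lee_fin; lra.
Qed.

End truncation.

Lemma Re_IPavg (R : realType) (A : {fset nat}) (n : nat -> nat) (a : nat -> R[i]) :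
  complex.Re (IPavg A n a) = IPavg A n (fun k => complex.Re (a k)).
Proof.
rewrite /IPavg -Re_sum -(rmorph_nat (real_complex R)) -rmorphXn -fmorphV /=.
by case: (\sum_(_ <- _) _) => x y /=; rewrite mul0r subr0.
Qed.

Lemma Im_IPavg (R : realType) (A : {fset nat}) (n : nat -> nat) (a : nat -> R[i]) :
  complex.Im (IPavg A n a) = IPavg A n (fun k => complex.Im (a k)).
Proof.
rewrite /IPavg -Im_sum -(rmorph_nat (real_complex R)) -rmorphXn -fmorphV /=.
by case: (\sum_(_ <- _) _) => x y /=; rewrite mul0r addr0.
Qed.

Theorem proposition3p4 (R : realType) (n : nat -> nat) (Phi : nat -> {fset nat})
  (n_gt0 : forall j, (0 < j)%N -> (0 < n j)%N)
  (PhiF : Folner R Phi)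
  (equi : forall (Z : topologicalZmodType) (nu : probability (zborel Z) R) (a : Z),
    ergodic_rotation nu a ->
    forall f : zborel Z -> R[i], L2 nu f ->
      cvgL2 nu (fun N x => avg (Phi N) (fun j => f (rotation (a *+ n j) x)))
               (fun=> cintegral nu f)) :
  forall (X : pointedMetricType R) (mu : probability (borel X) R)
         (T : borel X -> borel X),
    invertible_mps mu T -> ergodic mu T ->
    forall f : borel X -> R[i], L2 mu f ->
      cvgL2 mu (fun N x => IPavg (Phi N) n (fun k => f (iter k T x)))
               (fun=> cintegral mu f).

Proof.
move=> X mu T [_ _ mT _ muT] ergT f [mRe mIm fL2]; apply/cvgL2P.
pose u x := complex.Re (f x); pose v x := complex.Im (f x).
have mip (h : borel X -> R) : measurable_fun setT h ->
    forall N, measurable_fun setT (fun x => IPavg (Phi N) n (fun k => h (iter k T x)) - mean mu h).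
  move=> mh N; apply: measurable_funB => //; apply: measurable_funM => //.
  by apply: measurable_sum => F; exact: measurableT_comp mh (iter_measurable mT _).
have f2 : (\int[mu]_x (sqnorm (f x))%:E < +oo)%E.
  rewrite L2normE in fL2; rewrite ltey; apply/eqP => f2.
  by rewrite f2 in fL2.
have msq : measurable_fun setT (fun x => (sqnorm (f x))%:E).
  by apply/measurable_EFinP; apply: measurable_funD; exact: measurable_funX.
have u2 : (sqint mu u < +oo)%E.
  apply: le_lt_trans f2; apply: ge0_le_integral => //.
  - by move=> x _; rewrite lee_fin sqr_ge0.
  - exact: measurable_EFin_sqr.
  - by move=> x _; rewrite lee_fin lerDl sqr_ge0.
have v2 : (sqint mu v < +oo)%E.
  apply: le_lt_trans f2; apply: ge0_le_integral => //.
  - by move=> x _; rewrite lee_fin sqr_ge0.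
  - exact: measurable_EFin_sqr.
  - by move=> x _; rewrite lee_fin lerDr sqr_ge0.
have cu := sqint_ip_cvg0 mT muT ergT PhiF equi mRe u2.
have cv := sqint_ip_cvg0 mT muT ergT PhiF equi mIm v2.
have cuv := cvgeD (a := 0%E) (b := 0%E) isT cu cv; rewrite adde0 in cuv.
(* The IP weights are real, so the squared modulus of the error is the sum of the squared errors for
   the real and imaginary parts. *)
rewrite [X in X @ _ --> _](_ : _ = fun N =>
  (sqint mu (fun x => IPavg (Phi N) n (fun k => u (iter k T x)) - mean mu u)%R +
   sqint mu (fun x => IPavg (Phi N) n (fun k => v (iter k T x)) - mean mu v)%R)%E).
  exact: cuv.
apply/funext => N.
rewrite /sqint -ge0_integralD//; last 4 first.
- by move=> x _; rewrite lee_fin sqr_ge0.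
- by apply: measurable_EFin_sqr; exact: mip.
- by move=> x _; rewrite lee_fin sqr_ge0.
- by apply: measurable_EFin_sqr; exact: mip.
apply: eq_integral => x _; rewrite -EFinD; congr (_%:E).
by rewrite /u /v /sqnorm -Re_IPavg -Im_IPavg; case: (IPavg _ _ _).
Qed.
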